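(* The following are equivalent (in $\mathbf{ZF}$): (i) $\mathbf{CC}(\mathrm{fin})$: every non-void countable collection of pairwise disjoint non-void finite sets has a choice function; (ii) for every discrete space $X$, the bornological universe $(X,\mathbf{FB}(X))$ is metrizable (in the sense of Hu) if and only if $X$ is countable.
   Context: The set theory is $\mathbf{ZF}$ (no choice). A set is finite if it is equipollent with some $n\in\omega$, and countable if it is equipollent with a subset of $\omega$. A bornology in a set $X$ is a non-void ideal of subsets of $X$ (closed under subsets and finite unions) containing every singleton. $\mathbf{FB}(X)$ is the bornology of all finite subsets of $X$. A bornological universe is a pair consisting of a topological space $(X,\tau)$ and a bornology $\mathcal{B}$ in $X$. It is metrizable in the sense of Hu if there is a metric $d$ on $X$ such that $\tau$ is the topology induced by $d$ and $\mathcal{B}=\{A\subseteq X:\mathrm{diam}_d(A)<+\infty\}$, where $\mathrm{diam}_d(A)=\sup\{d(x,y):x,y\in A\}$. *)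

(* Defs.v *)
From Stdlib Require Import ClassicalEpsilon.

(** A theorem of ZF is rendered as a statement about every model of first-order
    ZF (Goedel completeness).  The separation and replacement schemes range over
    first-order formulas, not over all predicates [M -> Prop]: with the latter,
    choice in the metatheory would give choice inside every model. *)

(** Formulas in the language of set theory; variables are de Bruijn indices. *)
Inductive form : Type :=
| fMem (i j : nat)
| fEq (i j : nat)
| fBot
| fImp (p q : form)
| fAll (p : form).

Definition scons {V : Type} (x : V) (env : nat -> V) (n : nat) : V :=
  match n with 0 => x | S k => env k end.

Fixpoint sat {V : Type} (mem : V -> V -> Prop) (env : nat -> V) (p : form) : Prop :=
  match p with
  | fMem i j => mem (env i) (env j)
  | fEq i j => env i = env j
  | fBot => False
  | fImp q r => sat mem env q -> sat mem env r
  | fAll q => forall x : V, sat mem (scons x env) q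
  end.

(** In the two schemes [env] supplies the parameters of the formula. *)
Record ZF_model : Type := {
  univ :> Type;
  mem : univ -> univ -> Prop;
  zf_extensionality : forall a b,
    (forall x, mem x a <-> mem x b) -> a = b;
  zf_foundation : forall a, (exists x, mem x a) ->
    exists x, mem x a /\ forall y, mem y x -> ~ mem y a;
  zf_pairing : forall a b, exists p, forall x, mem x p <-> x = a \/ x = b;
  zf_union : forall a, exists u, forall x,
    mem x u <-> exists y, mem y a /\ mem x y;
  zf_power : forall a, exists p, forall x,
    mem x p <-> forall y, mem y x -> mem y a;
  zf_infinity : exists w,
    (exists e, mem e w /\ forall x, ~ mem x e) /\
    (forall n, mem n w -> exists s, mem s w /\ forall x, mem x s <-> mem x n \/ x = n);
  zf_separation : forall (p : form) (env : nat -> univ) a,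
    exists b, forall x, mem x b <-> mem x a /\ sat mem (scons x env) p;
  zf_replacement : forall (p : form) (env : nat -> univ) a,
    (forall x, mem x a -> exists! y, sat mem (scons x (scons y env)) p) ->
    exists b, forall y,
      mem y b <-> exists x, mem x a /\ sat mem (scons x (scons y env)) p
}.

Arguments mem {_} _ _.

Notation "x ∈ a" := (mem x a) (at level 70, no associativity).
Notation "x ∉ a" := (~ mem x a) (at level 70, no associativity).

Definition model_inhabited (M : ZF_model) : inhabited M :=
  match zf_infinity M with ex_intro _ w _ => inhabits w end.

(** Definite description.  It is only applied below to first-order definable
    conditions; where the intended object exists it is unique, and elsewhere
    the value is junk. *)
Definition the {M : ZF_model} (P : M -> Prop) : M := epsilon (model_inhabited M) P.

(** The set whose elements are the [x] with [P x] (junk if they form a proper class). *)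
Definition setof {M : ZF_model} (P : M -> Prop) : M :=
  the (fun s => forall x, x ∈ s <-> P x).

Notation "{{ x | P }}" := (setof (fun x => P)) (at level 0, x binder, P at level 200).

Section SetTheory.
Context {M : ZF_model}.
Implicit Types a b f x y z A B C I S X : M.

Definition subset A B : Prop := forall x, x ∈ A -> x ∈ B.
Definition empty : M := {{ x | False }}.
Definition upair a b : M := {{ x | x = a \/ x = b }}.
Definition single a : M := {{ x | x = a }}.
Definition bigunion A : M := {{ x | exists y, y ∈ A /\ x ∈ y }}.
Definition union A B : M := {{ x | x ∈ A \/ x ∈ B }}.
Definition inter A B : M := {{ x | x ∈ A /\ x ∈ B }}.
Definition powerset A : M := {{ B | subset B A }}.
Definition pair a b : M := upair (single a) (upair a b).
Definition prod A B : M := {{ p | exists a b, a ∈ A /\ b ∈ B /\ p = pair a b }}.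

Definition maps f A B : Prop :=
  subset f (prod A B) /\ forall a, a ∈ A -> exists! b, pair a b ∈ f.
Definition app f a : M := the (fun b => pair a b ∈ f).
Definition bijection f A B : Prop :=
  maps f A B /\ forall b, b ∈ B -> exists! a, pair a b ∈ f.
Definition equipollent A B : Prop := exists f, bijection f A B.

Definition succ n : M := {{ x | x ∈ n \/ x = n }}.
Definition inductive_set I : Prop :=
  empty ∈ I /\ forall n, n ∈ I -> succ n ∈ I.
Definition omega : M := {{ n | forall I, inductive_set I -> n ∈ I }}.

Definition finite A : Prop := exists n, n ∈ omega /\ equipollent A n.
Definition countable A : Prop := exists S, subset S omega /\ equipollent A S.

Definition choice_function f C : Prop :=
  maps f C (bigunion C) /\ forall A, A ∈ C -> app f A ∈ A.

Definition CC_fin : Prop :=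
  forall C, C <> empty -> countable C ->
    (forall A, A ∈ C -> A <> empty /\ finite A) ->
    (forall A B, A ∈ C -> B ∈ C -> A <> B -> inter A B = empty) ->
    exists f, choice_function f C.

(** Arithmetic of [omega] by internal recursion: [nat_iter g z n] is the [n]-th
    iterate of [g] at [z], for [g] mapping [omega] to [omega]; the order of
    [omega] is membership. *)
Definition nat_iter (g : M -> M) z n : M :=
  the (fun k => exists f, maps f omega omega /\ app f empty = z /\
    (forall i, i ∈ omega -> app f (succ i) = g (app f i)) /\ app f n = k).
Definition nat_add m n : M := nat_iter succ m n.
Definition nat_mul m n : M := nat_iter (fun k => nat_add k m) empty n.

(** [((a, b), c)] with [c <> 0] stands for the rational number [(a - b) / c].
    These are not quotiented: cuts below are closed under equality of the
    rationals represented, since they are downward closed without maximum. *)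
Definition frac a b c : M := pair (pair a b) c.
Definition is_frac q a b c : Prop :=
  a ∈ omega /\ b ∈ omega /\ c ∈ omega /\ c <> empty /\ q = frac a b c.
Definition is_rat q : Prop := exists a b c, is_frac q a b c.
Definition rat_lt p q : Prop :=
  exists a b c a' b' c', is_frac p a b c /\ is_frac q a' b' c' /\
    nat_add (nat_mul a c') (nat_mul b' c) ∈ nat_add (nat_mul a' c) (nat_mul b c').
Definition rat_add p q : M :=
  the (fun r => exists a b c a' b' c', is_frac p a b c /\ is_frac q a' b' c' /\
    r = frac (nat_add (nat_mul a c') (nat_mul a' c))
             (nat_add (nat_mul b c') (nat_mul b' c))
             (nat_mul c c')).

(** Real numbers are lower Dedekind cuts of rationals. *)
Definition is_real x : Prop :=
  (forall q, q ∈ x -> is_rat q) /\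
  (exists q, q ∈ x) /\
  (exists q, is_rat q /\ q ∉ x) /\
  (forall p q, q ∈ x -> rat_lt p q -> p ∈ x) /\
  (forall p, p ∈ x -> exists q, q ∈ x /\ rat_lt p q).
Definition reals : M := {{ x | is_real x }}.
Definition real_zero : M := {{ q | exists a b c, is_frac q a b c /\ a ∈ b }}.
Definition real_le x y : Prop := subset x y.
Definition real_lt x y : Prop := real_le x y /\ x <> y.
Definition real_add x y : M :=
  {{ r | exists p q, p ∈ x /\ q ∈ y /\ rat_lt r (rat_add p q) }}.

Definition is_topology X tau : Prop :=
  subset tau (powerset X) /\ empty ∈ tau /\ X ∈ tau /\
  (forall S, subset S tau -> bigunion S ∈ tau) /\
  (forall A B, A ∈ tau -> B ∈ tau -> inter A B ∈ tau).

Definition is_bornology X B : Prop :=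
  subset B (powerset X) /\ B <> empty /\
  (forall A A', A ∈ B -> subset A' A -> A' ∈ B) /\
  (forall A A', A ∈ B -> A' ∈ B -> union A A' ∈ B) /\
  (forall x, x ∈ X -> single x ∈ B).

Definition bornological_universe X tau B : Prop :=
  is_topology X tau /\ is_bornology X B.

Definition dist d x y : M := app d (pair x y).

Definition is_metric X d : Prop :=
  maps d (prod X X) reals /\
  (forall x y, x ∈ X -> y ∈ X -> real_le real_zero (dist d x y)) /\
  (forall x y, x ∈ X -> y ∈ X -> (dist d x y = real_zero <-> x = y)) /\
  (forall x y, x ∈ X -> y ∈ X -> dist d x y = dist d y x) /\
  (forall x y z, x ∈ X -> y ∈ X -> z ∈ X ->
     real_le (dist d x z) (real_add (dist d x y) (dist d y z))).

Definition ball X d x r : M := {{ y | y ∈ X /\ real_lt (dist d x y) r }}.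

Definition metric_topology X d : M :=
  {{ A | subset A X /\ forall x, x ∈ A ->
       exists r, r ∈ reals /\ real_lt real_zero r /\ subset (ball X d x r) A }}.

(** [r] is the supremum, taken in [[0, +oo]], of the distances between points
    of [A]; thus the empty set has diameter [0]. *)
Definition has_diam d A r : Prop :=
  let bound s := s ∈ reals /\ real_le real_zero s /\
    forall x y, x ∈ A -> y ∈ A -> real_le (dist d x y) s in
  bound r /\ forall s, bound s -> real_le r s.

Definition metric_bornology X d : M :=
  {{ A | subset A X /\ exists r, has_diam d A r }}.

Definition Hu_metrizable X tau B : Prop :=
  bornological_universe X tau B /\
  exists d, is_metric X d /\ tau = metric_topology X d /\ B = metric_bornology X d.

Definition FB X : M := {{ A | subset A X /\ finite A }}.

Definition discrete_topology X : M := powerset X.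

End SetTheory.

Arguments CC_fin M : clear implicits.

(* Main.v *)
From Stdlib Require Import ClassicalEpsilon PeanoNat Lia Ring.
Require Import Defs.

(** Both conditions are linked through maps [h : X -> omega] with finite fibres.  Such an [h] yields
    the metric [h x + h y + 1] (for [x <> y]), which is discrete and whose bounded sets are the finite
    ones; conversely, if a metric has the finite sets as its bounded sets, sending [x] to the least
    [n] with [d(z, x) <= n], for a fixed [z], has finite fibres.  Under CC(fin) one chooses, for each
    nonempty fibre, one of its finitely many enumerations, so that [X] is countable.  Conversely, the
    union of a countable disjoint family of finite sets maps to [omega] with finite fibres; if it is
    countable, taking least elements gives a choice function.

    Separation and induction in a model apply only to predicates definable with parameters, so every
    set is built from operations that are shown to be definable. *)

(** * Definability *)

(** CC(fin) picks one element from each finite set, whereas counting [X] needs an enumeration of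
    every nonempty fibre at once. The enumerations of a finite fibre onto its least cardinal again
    form a finite set, and those of different fibres are disjoint because a function determines its
    domain; hence CC(fin) picks all of them together. A point is then coded by its fibre and its
    place in the chosen enumeration.

    The omega of the model may be nonstandard, so [nat] cannot stand in for it: recursion and
    arithmetic are redone inside the model. Descriptions such as [app] and [nat_add] are epsilon
    terms with no formula attached; each is traded for a definable twin ([ap], [padd]) that agrees
    with it on the intended arguments. Reals are needed only through their comparison with natural
    numbers: the metric that is built has natural values, and a given metric is only compared with
    natural bounds. *)

Fixpoint rename (r : nat -> nat) (p : form) : form :=
  match p with
  | fMem i j => fMem (r i) (r j)
  | fEq i j => fEq (r i) (r j)
  | fBot => fBot
  | fImp p q => fImp (rename r p) (rename r q)
  | fAll p => fAll (rename (fun n => match n with 0 => 0 | S k => S (r k) end) p)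
  end.

Lemma sat_rename {V : Type} (E : V -> V -> Prop) (p : form) :
  forall (r : nat -> nat) (e e' : nat -> V), (forall n, e' n = e (r n)) ->
  (sat E e (rename r p) <-> sat E e' p).
Proof.
  induction p as [i j|i j| |p IHp q IHq|p IHp]; intros r e e' H; simpl.
  - now rewrite !H.
  - now rewrite !H.
  - tauto.
  - rewrite (IHp r e e' H), (IHq r e e' H). tauto.
  - assert (K : forall x : V,
      sat E (scons x e) (rename (fun n => match n with 0 => 0 | S k => S (r k) end) p) <->
      sat E (scons x e') p).
    { intro x. apply IHp. intros [|n]; simpl; auto. }
    split; intros A x; apply K, A.
Qed.

(* [v 0, e 0, v 1, e 1, ...]: variables sit at even indices, parameters at odd ones. *)
Fixpoint mix {V : Type} (v e : nat -> V) (n : nat) : V :=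
  match n with 0 => v 0 | S m => mix e (fun i => v (S i)) m end.

Lemma mix_even {V : Type} (i : nat) : forall v e : nat -> V, mix v e (2 * i) = v i.
Proof.
  induction i as [|i IH]; intros v e; [reflexivity|].
  replace (2 * S i) with (S (S (2 * i))) by lia. simpl mix. now rewrite IH.
Qed.

Lemma mix_odd {V : Type} (i : nat) (v e : nat -> V) : mix v e (2 * i + 1) = e i.
Proof. replace (2 * i + 1) with (S (2 * i)) by lia. simpl mix. apply mix_even. Qed.

Ltac mixes := repeat (first [rewrite mix_odd | rewrite mix_even]); reflexivity.

(** Relocates the two halves of an interleaved environment independently: variables by [f],
    parameters by [g]. The renamings of formulas below have this form. *)
Definition remix (f g : nat -> nat) (n : nat) : nat :=
  if Nat.even n then f (Nat.div2 n) else g (Nat.div2 n).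

Lemma mix_remix {V : Type} (f g : nat -> nat) (v e w : nat -> V) :
  (forall i, v i = w (f i)) -> (forall i, e i = w (g i)) ->
  forall n, mix v e n = w (remix f g n).
Proof.
  intros Hv He n. unfold remix. destruct (Nat.even n) eqn:E.
  - apply Nat.even_spec in E. destruct E as [i ->].
    now rewrite mix_even, Nat.div2_double.
  - assert (O : Nat.odd n = true) by (rewrite <- Nat.negb_even, E; reflexivity).
    apply Nat.odd_spec in O. destruct O as [i ->].
    rewrite mix_odd. replace (2 * i + 1) with (S (2 * i)) by lia.
    now rewrite Nat.div2_succ_double.
Qed.

Section Definability.
Context {M : ZF_model}.

(* First-order definable with parameters, the parameters being [e]. *)
Definition definable (P : (nat -> M) -> Prop) : Prop :=
  exists (p : form) (e : nat -> M), forall v, sat mem (mix v e) p <-> P v.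

(** The language has no terms, so an operation is definable when its graph is; index 0 holds the
    value and the arguments move up by one. *)
Definition defterm (t : (nat -> M) -> M) : Prop :=
  definable (fun v => v 0 = t (fun i => v (S i))).

Lemma definable_ext (P Q : (nat -> M) -> Prop) :
  definable P -> (forall v, P v <-> Q v) -> definable Q.
Proof.
  intros (p & e & H) K. exists p, e. intro v. rewrite H. apply K.
Qed.

Lemma definable_imp (P Q : (nat -> M) -> Prop) :
  definable P -> definable Q -> definable (fun v => P v -> Q v).
Proof.
  intros (p & e & H) (q & f & K).
  (* The new parameter sequence interleaves the two old ones: those of [p] are its even entries and
     those of [q] its odd entries. *)
  exists (fImp (rename (remix (fun i => 2 * i) (fun i => 2 * (2 * i) + 1)) p)
               (rename (remix (fun i => 2 * i) (fun i => 2 * (2 * i + 1) + 1)) q)),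
         (mix e f).
  intro v. cbn [sat].
  rewrite (sat_rename mem p _ _ (mix v e)).
  2:{ apply mix_remix; intro i; cbv beta; mixes. }
  rewrite (sat_rename mem q _ _ (mix v f)).
  2:{ apply mix_remix; intro i; cbv beta; mixes. }
  rewrite H, K. tauto.
Qed.

Lemma definable_forall (P : M -> (nat -> M) -> Prop) :
  definable (fun v => P (v 0) (fun i => v (S i))) ->
  definable (fun v => forall x, P x v).
Proof.
  intros (p & e & H).
  (* The quantifier puts its variable at index 0 and pushes the whole interleaved environment up by
     one, which changes the parity of every position. *)
  exists (fAll (rename (remix (fun i => match i with 0 => 0 | S j => S (2 * j) end)
                              (fun i => S (2 * i + 1))) p)), e.
  intro v. cbn [sat].
  assert (K : forall x : M, sat mem (scons x (mix v e)) (rename (remix (fun i => match i with 0 => 0 | S j => S (2 * j) end)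
                              (fun i => S (2 * i + 1))) p) <-> P x v).
  { intro x. rewrite (sat_rename mem p _ _ (mix (scons x v) e)).
    - rewrite H. simpl. reflexivity.
    - apply mix_remix.
      + intros [|i]; [reflexivity|]. cbn [scons]. now rewrite mix_even.
      + intro i. cbn [scons]. now rewrite mix_odd. }
  split; intros A x; apply K, A.
Qed.

(** A proposition that ignores the environment is true or false once and for all, so one of two
    closed formulas fits, whatever [Q] is made of. *)
Lemma definable_const (Q : Prop) : definable (fun _ => Q).
Proof.
  destruct (classic Q) as [H|H].
  - exists (fImp fBot fBot), (fun _ => epsilon (model_inhabited M) (fun _ => True)).
    intro v. simpl. tauto.
  - exists fBot, (fun _ => epsilon (model_inhabited M) (fun _ => True)).
    intro v. simpl. tauto.
Qed.

Lemma definable_not (P : (nat -> M) -> Prop) :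
  definable P -> definable (fun v => ~ P v).
Proof. intro H. apply definable_imp; [exact H|apply definable_const]. Qed.

Lemma definable_or (P Q : (nat -> M) -> Prop) :
  definable P -> definable Q -> definable (fun v => P v \/ Q v).
Proof.
  intros H K. apply definable_ext with (fun v => ~ P v -> Q v).
  - apply definable_imp; [now apply definable_not|exact K].
  - intro v. destruct (classic (P v)); tauto.
Qed.

Lemma definable_and (P Q : (nat -> M) -> Prop) :
  definable P -> definable Q -> definable (fun v => P v /\ Q v).
Proof.
  intros H K. apply definable_ext with (fun v => ~ (P v -> ~ Q v)).
  - apply definable_not, definable_imp; [exact H|now apply definable_not].
  - intro v. destruct (classic (P v)), (classic (Q v)); tauto.
Qed.

Lemma definable_iff (P Q : (nat -> M) -> Prop) :
  definable P -> definable Q -> definable (fun v => P v <-> Q v).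
Proof. intros H K. apply definable_and; now apply definable_imp. Qed.

Lemma definable_exists (P : M -> (nat -> M) -> Prop) :
  definable (fun v => P (v 0) (fun i => v (S i))) ->
  definable (fun v => exists x, P x v).
Proof.
  intro H. apply definable_ext with (fun v => ~ forall x, ~ P x v).
  - apply definable_not, definable_forall, definable_not, H.
  - intro v. split.
    + intro K. apply NNPP. intro L. apply K. intros x Px. apply L. now exists x.
    + intros (x & Px) K. exact (K x Px).
Qed.

Lemma definable_rename (r : nat -> nat) (P : (nat -> M) -> Prop) :
  definable P -> definable (fun v => P (fun i => v (r i))).
Proof.
  intros (p & e & H). exists (rename (remix (fun i => 2 * r i) (fun i => 2 * i + 1)) p), e.
  intro v. rewrite (sat_rename mem p _ _ (mix (fun i => v (r i)) e)); [apply H|].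
  apply mix_remix; intro i; cbv beta; mixes.
Qed.

Lemma defterm_rename (r : nat -> nat) (t : (nat -> M) -> M) :
  defterm t -> defterm (fun v => t (fun i => v (r i))).
Proof.
  exact (definable_rename (fun n => match n with 0 => 0 | S k => S (r k) end)
           (fun v => v 0 = t (fun i => v (S i)))).
Qed.

Lemma defterm_const (a : M) : defterm (fun _ => a).
Proof.
  exists (fEq (2 * 0) (2 * 0 + 1)), (fun _ => a). intro v.
  cbn [sat]. rewrite mix_even, mix_odd. reflexivity.
Qed.

Lemma defterm_var (i : nat) : defterm (fun v => v i).
Proof.
  exists (fEq (2 * 0) (2 * S i)), (fun _ => epsilon (model_inhabited M) (fun _ => True)).
  intro v. cbn [sat]. rewrite !mix_even. reflexivity.
Qed.

(** Thanks to this and its variants below, a relation or operation is shown definable once, at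
    variables, and may then be applied to any definable terms. *)
Lemma definable_subst (P : M -> (nat -> M) -> Prop) (t : (nat -> M) -> M) :
  definable (fun v => P (v 0) (fun i => v (S i))) -> defterm t ->
  definable (fun v => P (t v) v).
Proof.
  intros H K. apply definable_ext with (fun v => exists x, x = t v /\ P x v).
  - apply definable_exists, definable_and; [exact K|exact H].
  - intro v. split.
    + now intros (x & -> & Px).
    + intro Px. now exists (t v).
Qed.

Lemma definable_subst1 (P : M -> Prop) (s : (nat -> M) -> M) :
  definable (fun v => P (v 0)) -> defterm s -> definable (fun v => P (s v)).
Proof. exact (definable_subst (fun x _ => P x) s). Qed.

Lemma definable_subst2 (P : M -> M -> Prop) (s t : (nat -> M) -> M) :
  definable (fun v => P (v 0) (v 1)) -> defterm s -> defterm t ->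
  definable (fun v => P (s v) (t v)).
Proof.
  intros H K L.
  apply (definable_subst (fun y v => P (s v) y) t); [|exact L].
  apply (definable_subst (fun x v => P x (v 0)) (fun v => s (fun i => v (S i)))); [exact H|].
  now apply (defterm_rename S).
Qed.

Lemma definable_subst3 (P : M -> M -> M -> Prop) (s t u : (nat -> M) -> M) :
  definable (fun v => P (v 0) (v 1) (v 2)) -> defterm s -> defterm t -> defterm u ->
  definable (fun v => P (s v) (t v) (u v)).
Proof.
  intros H K L I.
  apply (definable_subst (fun y v => P (s v) (t v) y) u); [|exact I].
  apply (definable_subst (fun y v => P (s (fun i => v (S i))) y (v 0)) (fun v => t (fun i => v (S i)))).
  - apply (definable_subst (fun x v => P x (v 0) (v 1)) (fun v => s (fun i => v (S (S i))))); [exact H|].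
    now apply (defterm_rename (fun i => S (S i))).
  - now apply (defterm_rename S).
Qed.

Lemma defterm_subst1 (F : M -> M) (s : (nat -> M) -> M) :
  defterm (fun v => F (v 0)) -> defterm s -> defterm (fun v => F (s v)).
Proof.
  intros H K. unfold defterm.
  apply (definable_subst2 (fun y x => y = F x)); [exact H|apply defterm_var|].
  now apply (defterm_rename S).
Qed.

Lemma defterm_subst2 (F : M -> M -> M) (s t : (nat -> M) -> M) :
  defterm (fun v => F (v 0) (v 1)) -> defterm s -> defterm t ->
  defterm (fun v => F (s v) (t v)).
Proof.
  intros H K L. unfold defterm.
  apply (definable_subst3 (fun z x y => z = F x y)); [exact H|apply defterm_var| |];
    now apply (defterm_rename S).
Qed.

Lemma definable_mem (s t : (nat -> M) -> M) :
  defterm s -> defterm t -> definable (fun v => s v ∈ t v).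
Proof.
  apply (definable_subst2 (fun x y => x ∈ y)).
  exists (fMem (2 * 0) (2 * 1)), (fun _ => epsilon (model_inhabited M) (fun _ => True)).
  intro v. cbn [sat]. rewrite !mix_even. reflexivity.
Qed.

Lemma definable_eq (s t : (nat -> M) -> M) :
  defterm s -> defterm t -> definable (fun v => s v = t v).
Proof.
  apply (definable_subst2 (fun x y => x = y)).
  exists (fEq (2 * 0) (2 * 1)), (fun _ => epsilon (model_inhabited M) (fun _ => True)).
  intro v. cbn [sat]. rewrite !mix_even. reflexivity.
Qed.

Lemma separation (P : M -> Prop) (a : M) :
  definable (fun v => P (v 0)) -> exists b, forall x, x ∈ b <-> x ∈ a /\ P x.
Proof.
  intros (p & e & H).
  (* [P] reads only variable 0, so all variables may be sent to the separated element, which sits at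
     index 0 in front of the parameters. *)
  destruct (zf_separation M (rename (remix (fun _ => 0) S) p) e a) as (b & Hb).
  exists b. intro x. rewrite Hb.
  rewrite (sat_rename mem p _ _ (mix (fun _ => x) e)); [now rewrite H|].
  now apply mix_remix.
Qed.

Lemma setof_spec (P : M -> Prop) :
  (exists s, forall x, x ∈ s <-> P x) -> forall x, x ∈ setof P <-> P x.
Proof. intro H. unfold setof, the. exact (epsilon_spec (model_inhabited M) _ H). Qed.

Lemma setof_eq (P : M -> Prop) (s : M) : (forall x, x ∈ s <-> P x) -> setof P = s.
Proof.
  intro H. apply zf_extensionality. intro x. rewrite H. apply setof_spec. now exists s.
Qed.

Lemma setof_bounded (P : M -> Prop) (a : M) :
  definable (fun v => P (v 0)) -> (forall x, P x -> x ∈ a) ->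
  forall x, x ∈ setof P <-> P x.
Proof.
  intros H K. apply setof_spec. destruct (separation P a H) as (b & Hb).
  exists b. intro x. rewrite Hb. firstorder.
Qed.

Lemma the_eq (P : M -> Prop) (a : M) : P a -> (forall b, P b -> b = a) -> the P = a.
Proof. intros H K. apply K. unfold the. apply epsilon_spec. now exists a. Qed.

(** The second hypothesis excludes junk values of [setof] for every [v]; being the value is then the
    same as having the right elements, which is first-order. *)
Lemma defterm_setof (P : M -> (nat -> M) -> Prop) :
  definable (fun v => P (v 0) (fun i => v (S i))) ->
  (forall v x, x ∈ setof (fun y => P y v) <-> P x v) ->
  defterm (fun v => setof (fun x => P x v)).
Proof.
  intros H K. unfold defterm.
  apply definable_ext with (fun v => forall x, x ∈ v 0 <-> P x (fun i => v (S i))).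
  - apply definable_forall, definable_iff.
    + apply definable_mem; apply defterm_var.
    + exact (definable_rename (fun n => match n with 0 => 0 | S k => S (S k) end) _ H).
  - intro v. split; intro A.
    + symmetry. now apply setof_eq.
    + rewrite A. apply K.
Qed.

End Definability.

(** Redefined after each batch of definability lemmas, so that [dfn] recognises the operations
    treated so far. [dfn] closes its goal or fails. *)
Ltac dfn_hook := fail.
Ltac dstep :=
  first
    [ simple apply defterm_const
    | simple apply definable_const
    | apply defterm_var
    | match goal with
      | H : defterm (fun v => ?F (v 0)) |- defterm (fun v => ?F _) => apply (defterm_subst1 F _ H)
      | H : definable (fun v => ?P (v 0)) |- definable (fun v => ?P _) => apply (definable_subst1 P _ H)
      | H : definable (fun v => ?P (v 0) (v 1)) |- definable (fun v => ?P _ _) =>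
          apply (definable_subst2 P _ _ H)
      | H : defterm ?t |- defterm ?t => exact H
      | H : defterm ?t |- defterm (fun v => ?t v) => exact H
      end
    | dfn_hook
    | apply definable_mem
    | apply definable_eq
    | apply definable_and
    | apply definable_or
    | apply definable_not
    | apply definable_iff
    | apply definable_forall
    | apply definable_imp
    | apply definable_exists ].
Ltac dfn := cbv beta; dstep; [ dfn .. ].

(** * Sets, relations and functions in a model *)

Section BasicSets.
Context {M : ZF_model}.
Implicit Types a b c f x y z A B X : M.

Lemma in_empty x : ~ x ∈ (empty : M).
Proof.
  unfold empty. rewrite setof_spec; [tauto|].
  destruct (zf_infinity M) as (w & (e & _ & He) & _). exists e. firstorder.
Qed.

Lemma in_upair a b x : x ∈ upair a b <-> x = a \/ x = b.
Proof. unfold upair. refine (setof_spec _ _ x). apply zf_pairing. Qed.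

Lemma in_single a x : x ∈ single a <-> x = a.
Proof.
  unfold single. refine (setof_spec _ _ x). destruct (zf_pairing M a a) as (p & Hp).
  exists p. intro y. rewrite Hp. tauto.
Qed.

Lemma in_bigunion A x : x ∈ bigunion A <-> exists y, y ∈ A /\ x ∈ y.
Proof. unfold bigunion. refine (setof_spec _ _ x). apply zf_union. Qed.

Lemma in_union A B x : x ∈ union A B <-> x ∈ A \/ x ∈ B.
Proof.
  unfold union. refine (setof_spec _ _ x). exists (bigunion (upair A B)). intro y.
  rewrite in_bigunion. split.
  - intros (z & Hz & Hy). apply in_upair in Hz. destruct Hz as [->| ->]; auto.
  - intros [H|H]; [exists A|exists B]; rewrite in_upair; auto.
Qed.

Lemma in_powerset A B : B ∈ powerset A <-> subset B A.
Proof. refine (setof_spec _ _ B). apply zf_power. Qed.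

Definition sep A (P : M -> Prop) : M := {{ x | x ∈ A /\ P x }}.

Lemma in_sep A (P : M -> Prop) :
  definable (fun v => P (v 0)) -> forall x, x ∈ sep A P <-> x ∈ A /\ P x.
Proof. intros H x. unfold sep. refine (setof_spec _ _ x). now apply separation. Qed.

Lemma in_inter A B x : x ∈ inter A B <-> x ∈ A /\ x ∈ B.
Proof. apply (in_sep A (fun y => y ∈ B)). dfn. Qed.

Lemma defterm_sep (A : (nat -> M) -> M) (P : M -> (nat -> M) -> Prop) :
  defterm A -> definable (fun v => P (v 0) (fun i => v (S i))) ->
  defterm (fun v => sep (A v) (fun x => P x v)).
Proof.
  intros HA HP. unfold sep. apply (defterm_setof (fun x v => x ∈ A v /\ P x v)).
  - apply definable_and; [|exact HP]. apply definable_mem; [apply defterm_var|].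
    now apply (defterm_rename S).
  - intros v x. apply (in_sep (A v) (fun y => P y v)).
    destruct HP as (p & e & HP).
    (* With [v] fixed, its values become parameters, interleaved with the old parameters [e]; only
       the separated element remains a variable. *)
    exists (rename (remix (fun i => match i with 0 => 0 | S j => 2 * (2 * j) + 1 end) (fun i => 2 * (2 * i + 1) + 1)) p), (mix v e).
    intro w. rewrite (sat_rename mem p _ _ (mix (scons (w 0) v) e)).
    + now rewrite HP.
    + apply mix_remix.
      * intros [|i]; [now rewrite (mix_even 0)|]. now rewrite mix_odd, mix_even.
      * intro i. now rewrite !mix_odd.
Qed.

Lemma defterm_upair (s t : (nat -> M) -> M) :
  defterm s -> defterm t -> defterm (fun v => upair (s v) (t v)).
Proof.
  apply (defterm_subst2 upair). unfold upair.
  apply (defterm_setof (fun x v => x = v 0 \/ x = v 1)); [dfn|].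
  intros v x. apply in_upair.
Qed.

Lemma defterm_single (s : (nat -> M) -> M) : defterm s -> defterm (fun v => single (s v)).
Proof.
  apply (defterm_subst1 single). unfold single.
  apply (defterm_setof (fun x v => x = v 0)); [dfn|].
  intros v x. apply in_single.
Qed.

Lemma defterm_bigunion (s : (nat -> M) -> M) :
  defterm s -> defterm (fun v => bigunion (s v)).
Proof.
  apply (defterm_subst1 bigunion). unfold bigunion.
  apply (defterm_setof (fun x v => exists y, y ∈ v 0 /\ x ∈ y)); [dfn|].
  intros v x. apply in_bigunion.
Qed.

Lemma defterm_union (s t : (nat -> M) -> M) :
  defterm s -> defterm t -> defterm (fun v => union (s v) (t v)).
Proof.
  apply (defterm_subst2 union). unfold union.
  apply (defterm_setof (fun x v => x ∈ v 0 \/ x ∈ v 1)); [dfn|].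
  intros v x. apply in_union.
Qed.

Lemma defterm_powerset (s : (nat -> M) -> M) :
  defterm s -> defterm (fun v => powerset (s v)).
Proof.
  apply (defterm_subst1 powerset). unfold powerset, subset.
  apply (defterm_setof (fun x v => forall y, y ∈ x -> y ∈ v 0)); [dfn|].
  intros v x. apply in_powerset.
Qed.

Lemma defterm_pair (s t : (nat -> M) -> M) :
  defterm s -> defterm t -> defterm (fun v => pair (s v) (t v)).
Proof. intros H K. apply defterm_upair; [now apply defterm_single|now apply defterm_upair]. Qed.

Lemma single_inj a b : single a = single b -> a = b.
Proof. intro H. apply in_single. rewrite <- H. now apply in_single. Qed.

Lemma pair_inj a b a' b' : pair a b = pair a' b' <-> a = a' /\ b = b'.
Proof.
  split; [|now intros (-> & ->)]. unfold pair. intro H.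
  assert (E : forall x, x ∈ upair (single a) (upair a b) <-> x ∈ upair (single a') (upair a' b'))
    by (intro x; now rewrite H).
  assert (D : forall x y z : M, single x = upair y z -> x = y /\ x = z).
  { intros x y z K. assert (L : forall t, t = x <-> t = y \/ t = z).
    { intro t. rewrite <- in_single, K. apply in_upair. }
    split; symmetry; apply L; auto. }
  assert (Ha : a = a').
  { assert (K : single a ∈ upair (single a') (upair a' b')) by (apply E, in_upair; auto).
    apply in_upair in K. destruct K as [K|K]; [now apply single_inj|now apply D in K]. }
  subst a'. split; [reflexivity|].
  assert (K : upair a b ∈ upair (single a) (upair a b')) by (apply E, in_upair; auto).
  assert (L : upair a b' ∈ upair (single a) (upair a b)) by (apply E, in_upair; auto).
  apply in_upair in K, L.
  destruct K as [K|K].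
  - symmetry in K. apply D in K. destruct K as (_ & <-).
    destruct L as [L|L].
    + symmetry in L. now apply D in L.
    + assert (B : b' ∈ upair a a) by (rewrite <- L; apply in_upair; auto).
      apply in_upair in B. destruct B; congruence.
  - assert (B : b ∈ upair a b') by (rewrite <- K; apply in_upair; auto).
    assert (B' : b' ∈ upair a b) by (rewrite K; apply in_upair; auto).
    apply in_upair in B, B'. destruct B, B'; congruence.
Qed.

(** Supplies the bounding set that lets products be obtained by separation. *)
Lemma pair_in_bound a b A B : a ∈ A -> b ∈ B -> pair a b ∈ powerset (powerset (union A B)).
Proof.
  intros Ha Hb. apply in_powerset. intros x Hx. apply in_upair in Hx.
  apply in_powerset. destruct Hx as [->| ->]; intros y Hy; apply in_union.
  - apply in_single in Hy. subst. auto.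
  - apply in_upair in Hy. destruct Hy; subst; auto.
Qed.

End BasicSets.

Ltac dfn_sets :=
  lazymatch goal with
  | |- defterm (fun v => pair _ _) => apply defterm_pair
  | |- defterm (fun v => upair _ _) => apply defterm_upair
  | |- defterm (fun v => single _) => apply defterm_single
  | |- defterm (fun v => bigunion _) => apply defterm_bigunion
  | |- defterm (fun v => union _ _) => apply defterm_union
  | |- defterm (fun v => powerset _) => apply defterm_powerset
  | |- defterm (fun v => sep _ _) => apply defterm_sep
  end.
Ltac dfn_hook ::= dfn_sets.

(** * Products, functions and graphs of definable relations *)

Section Relations.
Context {M : ZF_model}.
Implicit Types a b c f x y z A B X : M.

Lemma in_prod A B x : x ∈ prod A B <-> exists a b, a ∈ A /\ b ∈ B /\ x = pair a b.
Proof.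
  unfold prod. refine (setof_bounded _ (powerset (powerset (union A B))) _ _ x); [dfn|].
  intros p (a & b & Ha & Hb & ->). now apply pair_in_bound.
Qed.

Lemma in_prod_pair A B a b : pair a b ∈ prod A B <-> a ∈ A /\ b ∈ B.
Proof.
  rewrite in_prod. split.
  - intros (a' & b' & Ha & Hb & E). apply pair_inj in E. destruct E; subst; auto.
  - intros (Ha & Hb). eauto.
Qed.

Lemma defterm_prod (s t : (nat -> M) -> M) :
  defterm s -> defterm t -> defterm (fun v => prod (s v) (t v)).
Proof.
  apply (defterm_subst2 prod). unfold prod.
  apply (defterm_setof (fun x v => exists a b, a ∈ v 0 /\ b ∈ v 1 /\ x = pair a b)); [dfn|].
  intros v x. apply in_prod.
Qed.

(* Unlike [app], this is first-order definable without a proof that [f] is a function at [a]. *)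
Definition ap f a : M := bigunion (sep (bigunion (bigunion f)) (fun b => pair a b ∈ f)).

Lemma defterm_ap (s t : (nat -> M) -> M) :
  defterm s -> defterm t -> defterm (fun v => ap (s v) (t v)).
Proof. apply (defterm_subst2 ap). unfold ap. dfn. Qed.

Lemma ap_unique f a b : (forall c, pair a c ∈ f <-> c = b) -> ap f a = b.
Proof.
  intro H. apply zf_extensionality. intro x. unfold ap. rewrite in_bigunion. split.
  - intros (y & Hy & Hx). rewrite in_sep in Hy by dfn. destruct Hy as (_ & Hy).
    apply H in Hy. now subst.
  - intro Hx. exists b. split; [|exact Hx]. apply in_sep; [dfn|].
    assert (K : pair a b ∈ f) by now apply H.
    split; [|exact K]. apply in_bigunion. exists (upair a b). split; [|apply in_upair; auto].
    apply in_bigunion. exists (pair a b). split; [exact K|]. apply in_upair; auto.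
Qed.

Lemma maps_unique f A B a : maps f A B -> a ∈ A ->
  exists b, b ∈ B /\ forall c, pair a c ∈ f <-> c = b.
Proof.
  intros (Hs & H) Ha. destruct (H a Ha) as (b & Hb & U). exists b. split.
  - apply (in_prod_pair A B a b). now apply Hs.
  - intro c. split; [intro K; symmetry; auto|now intros ->].
Qed.

Lemma maps_ap f A B a b : maps f A B -> a ∈ A -> (pair a b ∈ f <-> b = ap f a).
Proof.
  intros H Ha. destruct (maps_unique f A B a H Ha) as (c & _ & K).
  rewrite (ap_unique f a c K). apply K.
Qed.

Lemma maps_ap_in f A B a : maps f A B -> a ∈ A -> ap f a ∈ B.
Proof.
  intros H Ha. destruct (maps_unique f A B a H Ha) as (c & Hc & K).
  now rewrite (ap_unique f a c K).
Qed.

Lemma app_ap f A B a : maps f A B -> a ∈ A -> app f a = ap f a.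
Proof.
  intros H Ha. unfold app. apply the_eq.
  - now apply (maps_ap f A B).
  - intro b. now apply (maps_ap f A B).
Qed.

Lemma maps_dom f A B a b : maps f A B -> pair a b ∈ f -> a ∈ A.
Proof. intros (H & _) K. apply H, in_prod_pair in K. tauto. Qed.

Definition graph A B (R : M -> M -> Prop) : M :=
  sep (prod A B) (fun p => exists a b, p = pair a b /\ R a b).

Lemma in_graph A B (R : M -> M -> Prop) a b : definable (fun v => R (v 0) (v 1)) ->
  (pair a b ∈ graph A B R <-> a ∈ A /\ b ∈ B /\ R a b).
Proof.
  intro D. unfold graph. rewrite in_sep by dfn. rewrite in_prod_pair. split.
  - intros (H & a' & b' & E & K). apply pair_inj in E. destruct E; subst. tauto.
  - intros (Ha & Hb & H). split; eauto.
Qed.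

Lemma graph_maps A B (R : M -> M -> Prop) : definable (fun v => R (v 0) (v 1)) ->
  (forall a, a ∈ A -> exists b, b ∈ B /\ R a b) ->
  (forall a b c, a ∈ A -> b ∈ B -> c ∈ B -> R a b -> R a c -> b = c) ->
  maps (graph A B R) A B.
Proof.
  intros D E U. split.
  - intros p Hp. unfold graph in Hp. rewrite in_sep in Hp by dfn. tauto.
  - intros a Ha. destruct (E a Ha) as (b & Hb & Rab). exists b. split.
    + apply in_graph; auto.
    + intros c Hc. apply in_graph in Hc; [|exact D]. destruct Hc as (_ & Hc & Rac).
      now apply (U a).
Qed.

Lemma subset_antisym A B : subset A B -> subset B A -> A = B.
Proof. intros H K. apply zf_extensionality. intro x; split; auto. Qed.

Lemma nonempty A : A <> empty -> exists x, x ∈ A.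
Proof.
  intro H. apply NNPP. intro K. apply H, zf_extensionality. intro x. split; intro L.
  - destruct K. eauto.
  - now apply in_empty in L.
Qed.

Lemma mem_nonempty A x : x ∈ A -> A <> empty.
Proof. intros H E. subst. now apply in_empty in H. Qed.

End Relations.

Ltac dfn_relations :=
  lazymatch goal with
  | |- defterm (fun v => ap _ _) => apply defterm_ap
  | |- defterm (fun v => prod _ _) => apply defterm_prod
  end.
Ltac dfn_hook ::= first [ dfn_sets | dfn_relations ].

(** * The natural numbers of a model *)

Section Omega.
Context {M : ZF_model}.
Implicit Types a b c f g i j k m n x y z A B I X : M.

Lemma in_succ n x : x ∈ succ n <-> x ∈ n \/ x = n.
Proof.
  unfold succ. refine (setof_spec _ _ x). exists (union n (single n)). intro y.
  now rewrite in_union, in_single.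
Qed.

Lemma defterm_succ (s : (nat -> M) -> M) : defterm s -> defterm (fun v => succ (s v)).
Proof.
  apply (defterm_subst1 succ). unfold succ.
  apply (defterm_setof (fun x v => x ∈ v 0 \/ x = v 0)); [dfn|].
  intros v x. apply in_succ.
Qed.

Lemma definable_inductive (s : (nat -> M) -> M) :
  defterm s -> definable (fun v => inductive_set (s v)).
Proof.
  apply (definable_subst1 inductive_set). unfold inductive_set.
  apply definable_and; [dfn|].
  apply definable_forall, definable_imp; [dfn|].
  apply definable_mem; [|dfn]. apply defterm_succ. dfn.
Qed.

Lemma mem_irrefl x : ~ x ∈ x.
Proof.
  intro H. destruct (zf_foundation M (single x)) as (y & Hy & K).
  - exists x. now apply in_single.
  - apply in_single in Hy. subst y. apply (K x H). now apply in_single.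
Qed.

Lemma mem_asym x y : x ∈ y -> ~ y ∈ x.
Proof.
  intros H L. destruct (zf_foundation M (upair x y)) as (z & Hz & K).
  - exists x. apply in_upair. auto.
  - apply in_upair in Hz. destruct Hz as [->| ->].
    + apply (K y L). apply in_upair. auto.
    + apply (K x H). apply in_upair. auto.
Qed.

Lemma inductive_exists : exists I, inductive_set I.
Proof.
  destruct (zf_infinity M) as (w & (e & He & E) & S). exists w. split.
  - replace empty with e; [exact He|]. apply zf_extensionality. intro x. split; intro H.
    + now apply E in H.
    + now apply in_empty in H.
  - intros n Hn. destruct (S n Hn) as (s & Hs & K). replace (succ n) with s; [exact Hs|].
    apply zf_extensionality. intro x. now rewrite K, in_succ.
Qed.

Lemma in_omega n : n ∈ omega <-> forall I, inductive_set I -> n ∈ I.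
Proof.
  destruct inductive_exists as (I & HI). unfold omega. refine (setof_bounded _ I _ _ n).
  - apply definable_forall, definable_imp; [apply definable_inductive; dfn|dfn].
  - auto.
Qed.

Lemma omega_0 : empty ∈ (omega : M).
Proof. apply in_omega. intros I HI. apply HI. Qed.

Lemma omega_S n : n ∈ omega -> succ n ∈ omega.
Proof. intros H. apply in_omega. intros I HI. apply HI. rewrite in_omega in H. auto. Qed.

Lemma omega_ind (P : M -> Prop) : definable (fun v => P (v 0)) -> P empty ->
  (forall n, n ∈ omega -> P n -> P (succ n)) -> forall n, n ∈ omega -> P n.
Proof.
  intros D H0 HS n Hn.
  assert (K : n ∈ sep omega P).
  { pose proof Hn as Hn'. rewrite in_omega in Hn'. apply Hn'. split.
    - apply in_sep; [exact D|]. split; [apply omega_0|exact H0].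
    - intros m Hm. rewrite in_sep in Hm |- * by exact D. destruct Hm as (Hm & Pm).
      split; [now apply omega_S|auto]. }
  rewrite in_sep in K by exact D. tauto.
Qed.

End Omega.

(** Reads the induction predicate off the goal; the first subgoal left is its definability. *)
Ltac oind :=
  match goal with |- forall x, x ∈ omega -> @?P x => apply (omega_ind P) end; cbv beta.

Section OmegaOrder.
Context {M : ZF_model}.
Implicit Types a b c f g i j k m n x y z A B I X : M.

Lemma omega_case n : n ∈ omega -> n = empty \/ exists m, m ∈ omega /\ n = succ m.
Proof.
  revert n. oind.
  - apply definable_or; [dfn|]. apply definable_exists, definable_and; [dfn|].
    apply definable_eq; [dfn|]. apply defterm_succ. dfn.
  - auto.
  - eauto.
Qed.

Lemma succ_nonempty n : succ n <> empty.
Proof. apply mem_nonempty with n. apply in_succ. auto. Qed.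

(** If [m] and [n] differed, each would be a member of the other, against foundation. *)
Lemma succ_inj m n : succ m = succ n -> m = n.
Proof.
  intro E.
  assert (H : m ∈ succ n) by (rewrite <- E; apply in_succ; auto).
  assert (K : n ∈ succ m) by (rewrite E; apply in_succ; auto).
  apply in_succ in H, K. destruct H as [H|H]; [|exact H].
  destruct K as [K|K]; [|auto]. now apply mem_asym in H.
Qed.

Lemma omega_trans n : n ∈ omega -> forall m, m ∈ n -> m ∈ omega.
Proof.
  revert n. oind; [dfn| |].
  - intros m H. now apply in_empty in H.
  - intros n Hn IH m Hm. apply in_succ in Hm. destruct Hm; subst; auto.
Qed.

(** Foundation gives a membership-minimal element of the separated set; as elements of naturals are
    naturals, it is least. *)
Lemma omega_least (P : M -> Prop) : definable (fun v => P (v 0)) ->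
  (exists n, n ∈ omega /\ P n) ->
  exists n, n ∈ omega /\ P n /\ forall m, m ∈ n -> ~ P m.
Proof.
  intros D (k & Hk & Pk).
  destruct (zf_foundation M (sep omega P)) as (n & Hn & L).
  - exists k. apply in_sep; auto.
  - rewrite in_sep in Hn by exact D. destruct Hn as (Hn & Pn). exists n.
    repeat split; auto. intros m Hm Pm. apply (L m Hm). apply in_sep; [exact D|].
    split; [now apply (omega_trans n)|exact Pm].
Qed.

(* An intersection of closed relations rather than a union of partial functions: it is definable
   from [g] and [z] with no side condition. *)
Definition iter_graph g z : M :=
  sep (prod omega omega) (fun p => forall R : M,
    pair empty z ∈ R ->
    (forall i y y', pair i y ∈ R -> pair y y' ∈ g -> pair (succ i) y' ∈ R) -> p ∈ R).

End OmegaOrder.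

Ltac dfn_succ :=
  lazymatch goal with |- defterm (fun v => succ _) => apply defterm_succ end.
Ltac dfn_hook ::= first [ dfn_sets | dfn_relations | dfn_succ ].

(** * Recursion inside the model; addition and multiplication *)

Section Arithmetic.
Context {M : ZF_model}.
Implicit Types a b c f g i j k m n x y z A B I X : M.

Lemma defterm_iter_graph (s t : (nat -> M) -> M) :
  defterm s -> defterm t -> defterm (fun v => iter_graph (s v) (t v)).
Proof. apply (defterm_subst2 iter_graph). unfold iter_graph. dfn. Qed.

Lemma in_iter_graph g z p : p ∈ iter_graph g z <-> p ∈ prod omega omega /\ (forall R : M,
    pair empty z ∈ R ->
    (forall i y y', pair i y ∈ R -> pair y y' ∈ g -> pair (succ i) y' ∈ R) -> p ∈ R).
Proof. unfold iter_graph. apply in_sep. dfn. Qed.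

Lemma iter_graph_0 g z : z ∈ omega -> pair empty z ∈ iter_graph g z.
Proof.
  intro Hz. apply in_iter_graph. split; [|auto].
  apply in_prod_pair. split; [apply omega_0|exact Hz].
Qed.

Lemma iter_graph_S g z i y y' : maps g omega omega ->
  pair i y ∈ iter_graph g z -> pair y y' ∈ g -> pair (succ i) y' ∈ iter_graph g z.
Proof.
  intros Hg H K. apply in_iter_graph in H. destruct H as (H & L).
  apply in_prod_pair in H. apply in_iter_graph. split.
  - apply in_prod_pair. split; [now apply omega_S|].
    destruct Hg as (Hg & _). apply Hg, in_prod_pair in K. tauto.
  - intros R R0 RS. apply (RS i y y'); auto.
Qed.

(** Minimality at work: the pairs of one of the two forms already make up a closed relation, so the
    intersection of all closed relations contains no others. *)
Lemma iter_graph_inv g z p : maps g omega omega -> z ∈ omega -> p ∈ iter_graph g z ->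
  p = pair empty z \/
  exists i y y', pair i y ∈ iter_graph g z /\ pair y y' ∈ g /\ p = pair (succ i) y'.
Proof.
  intros Hg Hz Hp. pose proof Hp as Hp'. apply in_iter_graph in Hp'. destruct Hp' as (_ & L).
  set (Q := fun p : M => p = pair empty z \/
    exists i y y', pair i y ∈ iter_graph g z /\ pair y y' ∈ g /\ p = pair (succ i) y').
  assert (D : definable (fun v : nat -> M => Q (v 0))) by (unfold Q; dfn).
  assert (K : p ∈ sep (iter_graph g z) Q).
  { apply L.
    - apply in_sep; [exact D|]. split; [now apply iter_graph_0|now left].
    - intros i y y' H E. rewrite in_sep in H |- * by exact D. destruct H as (H & _). split.
      + now apply iter_graph_S with y.
      + right. now exists i, y, y'. }
  rewrite in_sep in K by exact D. apply K.
Qed.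

Lemma iter_graph_maps g z : maps g omega omega -> z ∈ omega ->
  maps (iter_graph g z) omega omega.
Proof.
  intros Hg Hz. split.
  - intros p Hp. apply in_iter_graph in Hp. tauto.
  - oind; [unfold unique; pose proof defterm_iter_graph; dfn| |].
    + exists z. split; [now apply iter_graph_0|]. intros y Hy.
      apply iter_graph_inv in Hy; auto. destruct Hy as [E|(i & y1 & y2 & _ & _ & E)];
      apply pair_inj in E; destruct E as (E & E'); [auto|].
      symmetry in E. now apply succ_nonempty in E.
    + intros n Hn (y & Hy & U).
      assert (Yo : y ∈ omega) by (apply in_iter_graph in Hy; destruct Hy as (Hy & _);
        apply in_prod_pair in Hy; tauto).
      destruct (maps_unique g omega omega y Hg Yo) as (y' & Hy' & K). exists y'. split.
      * apply iter_graph_S with y; auto. now apply K.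
      * intros c Hc. apply iter_graph_inv in Hc; auto.
        destruct Hc as [E|(i & y1 & y2 & Hi & Hyy & E)]; apply pair_inj in E; destruct E as (E & E').
        -- now apply succ_nonempty in E.
        -- apply succ_inj in E. subst i y2. assert (y = y1) by auto. subst y1.
           symmetry. now apply K.
Qed.

Definition iter g z n : M := ap (iter_graph g z) n.

Lemma iter_0 g z : maps g omega omega -> z ∈ omega -> iter g z empty = z.
Proof.
  intros Hg Hz. symmetry. apply (maps_ap _ _ _ _ _ (iter_graph_maps g z Hg Hz) omega_0).
  now apply iter_graph_0.
Qed.

Lemma iter_in g z n : maps g omega omega -> z ∈ omega -> n ∈ omega -> iter g z n ∈ omega.
Proof. intros Hg Hz. apply maps_ap_in. now apply iter_graph_maps. Qed.

Lemma iter_S g z n : maps g omega omega -> z ∈ omega -> n ∈ omega ->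
  iter g z (succ n) = ap g (iter g z n).
Proof.
  intros Hg Hz Hn. pose proof (iter_graph_maps g z Hg Hz) as Hi. symmetry.
  apply (maps_ap _ _ _ _ _ Hi (omega_S n Hn)).
  apply iter_graph_S with (iter g z n); [exact Hg| |].
  - now apply (maps_ap _ _ _ _ _ Hi Hn).
  - apply (maps_ap g omega omega); [exact Hg|now apply iter_in|reflexivity].
Qed.

(** The bridge from the description [nat_iter], which iterates a function of the metatheory, to the
    definable [iter]. Any internal function obeying the recursion agrees with [iter] by induction,
    which gives the uniqueness that the description needs. *)
Lemma nat_iter_iter (G : M -> M) g z n : maps g omega omega -> z ∈ omega -> n ∈ omega ->
  (forall k, k ∈ omega -> G k = ap g k) -> nat_iter G z n = iter g z n.
Proof.
  intros Hg Hz Hn HG. pose proof (iter_graph_maps g z Hg Hz) as Hi.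
  unfold nat_iter. apply the_eq.
  - exists (iter_graph g z). split; [exact Hi|]. split; [|split].
    + rewrite (app_ap _ _ _ _ Hi omega_0). now apply iter_0.
    + intros i Ho. rewrite !(app_ap _ _ _ _ Hi) by auto using omega_S.
      rewrite HG by now apply iter_in. now apply iter_S.
    + now apply (app_ap _ _ _ _ Hi).
  - intros k (f & Hf & F0 & FS & <-).
    rewrite (app_ap _ _ _ _ Hf Hn). rewrite (app_ap _ _ _ _ Hf omega_0) in F0.
    revert n Hn. oind.
    + unfold iter. pose proof defterm_iter_graph; dfn.
    + rewrite F0. symmetry. now apply iter_0.
    + intros n Hn IH. rewrite iter_S, <- IH by auto.
      specialize (FS n Hn). rewrite !(app_ap _ _ _ _ Hf) in FS by auto using omega_S.
      rewrite FS. apply HG. rewrite IH. now apply iter_in.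
Qed.

(** [padd] and [pmul] are the definable twins of [nat_add] and [nat_mul]; the graphs turn the
    iterated operations into sets. *)
Definition succ_graph : M := graph omega omega (fun n k => k = succ n).
Definition padd m n : M := iter succ_graph m n.
Definition padd_graph m : M := graph omega omega (fun k l => l = padd k m).
Definition pmul m n : M := iter (padd_graph m) empty n.

Lemma defterm_padd (s t : (nat -> M) -> M) :
  defterm s -> defterm t -> defterm (fun v => padd (s v) (t v)).
Proof. intros H K. unfold padd, iter. apply defterm_ap; [|exact K]. apply defterm_iter_graph; dfn. Qed.

Lemma defterm_pmul (s t : (nat -> M) -> M) :
  defterm s -> defterm t -> defterm (fun v => pmul (s v) (t v)).
Proof.
  apply (defterm_subst2 pmul). unfold pmul, iter, padd_graph, graph.
  apply defterm_ap; [|dfn]. apply defterm_iter_graph; [|dfn].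
  apply defterm_sep; [dfn|].
  apply definable_exists, definable_exists, definable_and; [dfn|].
  apply definable_eq; [dfn|]. apply defterm_padd; dfn.
Qed.

Lemma maps_graph_term A B (F : M -> M) : defterm (fun v => F (v 0)) ->
  (forall a, a ∈ A -> F a ∈ B) ->
  maps (graph A B (fun a b => b = F a)) A B /\
  forall a, a ∈ A -> ap (graph A B (fun a b => b = F a)) a = F a.
Proof.
  intros D H.
  assert (K : maps (graph A B (fun a b => b = F a)) A B).
  { apply graph_maps; [dfn|eauto|]. intros a b c _ _ _ -> ->. reflexivity. }
  split; [exact K|]. intros a Ha. symmetry. apply (maps_ap _ _ _ _ _ K Ha).
  apply in_graph; [dfn|]. auto.
Qed.

Lemma succ_graph_spec :
  maps succ_graph omega omega /\ forall n, n ∈ omega -> ap succ_graph n = succ n.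
Proof. apply maps_graph_term; [dfn|]. apply omega_S. Qed.

Lemma padd_in m n : m ∈ omega -> n ∈ omega -> padd m n ∈ omega.
Proof. intros. unfold pmul. apply iter_in; auto. apply succ_graph_spec. Qed.

Lemma padd_0 m : m ∈ omega -> padd m empty = m.
Proof. intros. apply iter_0; auto. apply succ_graph_spec. Qed.

Lemma padd_S m n : m ∈ omega -> n ∈ omega -> padd m (succ n) = succ (padd m n).
Proof.
  intros. destruct succ_graph_spec as (S1 & S2). unfold padd. rewrite iter_S by auto.
  apply S2. now apply padd_in.
Qed.

Lemma nat_add_padd m n : m ∈ omega -> n ∈ omega -> nat_add m n = padd m n.
Proof.
  intros. destruct succ_graph_spec as (S1 & S2).
  unfold nat_add. apply nat_iter_iter; auto. intros k Hk. symmetry. auto.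
Qed.

Lemma padd_graph_spec m : m ∈ omega ->
  maps (padd_graph m) omega omega /\ forall n, n ∈ omega -> ap (padd_graph m) n = padd n m.
Proof.
  intro Hm. apply (maps_graph_term omega omega (fun k => padd k m)).
  - apply defterm_padd; dfn.
  - intros a Ha. now apply padd_in.
Qed.

Lemma pmul_in m n : m ∈ omega -> n ∈ omega -> pmul m n ∈ omega.
Proof. intros. unfold pmul. apply iter_in; [now apply padd_graph_spec|apply omega_0|assumption]. Qed.

Lemma pmul_0 m : m ∈ omega -> pmul m empty = empty.
Proof. intros. unfold pmul. apply iter_0; [now apply padd_graph_spec|apply omega_0]. Qed.

Lemma pmul_S m n : m ∈ omega -> n ∈ omega -> pmul m (succ n) = padd (pmul m n) m.
Proof.
  intros. destruct (padd_graph_spec m) as (S1 & S2); auto.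
  unfold pmul. rewrite iter_S; [|exact S1|apply omega_0|assumption]. apply S2. now apply pmul_in.
Qed.

Lemma nat_mul_pmul m n : m ∈ omega -> n ∈ omega -> nat_mul m n = pmul m n.
Proof.
  intros. destruct (padd_graph_spec m) as (S1 & S2); auto.
  unfold nat_mul, pmul. apply (nat_iter_iter (fun k => nat_add k m)); [exact S1|apply omega_0|assumption|]. intros k Hk. rewrite S2 by auto.
  now apply nat_add_padd.
Qed.

End Arithmetic.

Ltac dfn_arithmetic :=
  lazymatch goal with
  | |- defterm (fun v => iter_graph _ _) => apply defterm_iter_graph
  | |- defterm (fun v => padd _ _) => apply defterm_padd
  | |- defterm (fun v => pmul _ _) => apply defterm_pmul
  end.
Ltac dfn_hook ::= first [ dfn_sets | dfn_relations | dfn_succ | dfn_arithmetic ].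

(** * The semiring of natural numbers of the model and its order *)

Section Naturals.
Context {M : ZF_model}.

Lemma padd_0l (n : M) : n ∈ omega -> padd empty n = n.
Proof.
  revert n. oind; [dfn|apply padd_0, omega_0|].
  intros n Hn IH. rewrite padd_S by (apply omega_0 || exact Hn). now rewrite IH.
Qed.

Lemma padd_Sl (m n : M) : m ∈ omega -> n ∈ omega -> padd (succ m) n = succ (padd m n).
Proof.
  intro Hm. revert n. oind; [dfn| |].
  - rewrite !padd_0; auto using omega_S.
  - intros n Hn IH. rewrite !padd_S, IH by auto using omega_S. reflexivity.
Qed.

Lemma padd_comm (m n : M) : m ∈ omega -> n ∈ omega -> padd m n = padd n m.
Proof.
  intro Hm. revert n. oind; [dfn| |].
  - now rewrite padd_0l, padd_0.
  - intros n Hn IH. now rewrite padd_S, padd_Sl, IH.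
Qed.

Lemma padd_assoc (l m n : M) : l ∈ omega -> m ∈ omega -> n ∈ omega ->
  padd l (padd m n) = padd (padd l m) n.
Proof.
  intros Hl Hm. revert n. oind; [dfn| |].
  - now rewrite !padd_0 by auto using padd_in.
  - intros n Hn IH. rewrite !padd_S, IH by auto using padd_in. reflexivity.
Qed.

Lemma pmul_0l (n : M) : n ∈ omega -> pmul empty n = empty.
Proof.
  revert n. oind; [dfn|apply pmul_0, omega_0|].
  intros n Hn IH. rewrite pmul_S by (apply omega_0 || exact Hn). rewrite IH.
  apply padd_0, omega_0.
Qed.

Lemma pmul_Sl (m n : M) : m ∈ omega -> n ∈ omega -> pmul (succ m) n = padd (pmul m n) n.
Proof.
  intro Hm. revert n. oind; [dfn| |].
  - rewrite !pmul_0, padd_0 by auto using omega_S, omega_0. reflexivity.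
  - intros n Hn IH. rewrite !pmul_S, IH by auto using omega_S.
    rewrite !padd_S by auto using padd_in, pmul_in.
    rewrite <- !padd_assoc by auto using pmul_in. now rewrite (padd_comm n m).
Qed.

Lemma pmul_comm (m n : M) : m ∈ omega -> n ∈ omega -> pmul m n = pmul n m.
Proof.
  intro Hm. revert n. oind; [dfn| |].
  - now rewrite pmul_0l, pmul_0.
  - intros n Hn IH. now rewrite pmul_S, pmul_Sl, IH.
Qed.

Lemma pmul_padd_l (m n l : M) : m ∈ omega -> n ∈ omega -> l ∈ omega ->
  pmul (padd m n) l = padd (pmul m l) (pmul n l).
Proof.
  intros Hm Hn. revert l. oind; [dfn| |].
  - rewrite !pmul_0, padd_0 by auto using padd_in, omega_0. reflexivity.
  - intros l Hl IH. rewrite !pmul_S, IH by auto using padd_in.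
    rewrite <- !padd_assoc by auto using padd_in, pmul_in. f_equal.
    rewrite !padd_assoc by auto using padd_in, pmul_in. f_equal.
    apply padd_comm; auto using pmul_in.
Qed.

Lemma pmul_assoc (l m n : M) : l ∈ omega -> m ∈ omega -> n ∈ omega ->
  pmul l (pmul m n) = pmul (pmul l m) n.
Proof.
  intros Hl Hm. revert n. oind; [dfn| |].
  - rewrite !pmul_0 by auto using pmul_in. reflexivity.
  - intros n Hn IH. rewrite !pmul_S, <- IH by auto using pmul_in.
    rewrite (pmul_comm l) by auto using padd_in, pmul_in.
    rewrite pmul_padd_l by auto using pmul_in.
    rewrite (pmul_comm (pmul m n)), (pmul_comm m l) by auto using pmul_in. reflexivity.
Qed.

(** Packaging the internal omega as a type frees the algebra from membership side conditions and
    makes [ring] available. *)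
Definition N : Type := {n : M | n ∈ omega}.
Definition val (n : N) : M := proj1_sig n.

Lemma val_omega (n : N) : val n ∈ omega.
Proof. exact (proj2_sig n). Qed.

Lemma val_inj (m n : N) : val m = val n -> m = n.
Proof. apply eq_sig_hprop. intro x. apply proof_irrelevance. Qed.

Lemma val_surj (n : M) : n ∈ omega -> exists m : N, n = val m.
Proof. intro H. now exists (exist _ n H). Qed.

Definition zero : N := exist _ empty omega_0.
Definition one : N := exist _ (succ empty) (omega_S _ omega_0).
Definition plus (m n : N) : N :=
  exist _ (padd (val m) (val n)) (padd_in _ _ (val_omega m) (val_omega n)).
Definition times (m n : N) : N :=
  exist _ (pmul (val m) (val n)) (pmul_in _ _ (val_omega m) (val_omega n)).

Lemma N_semiring : semi_ring_theory zero one plus times eq.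
Proof.
  split; intros; apply val_inj; simpl;
    auto using padd_0l, padd_comm, padd_assoc, pmul_0l, pmul_comm, pmul_assoc, pmul_padd_l,
      val_omega.
  rewrite pmul_Sl, pmul_0l, padd_0l by auto using val_omega, omega_0. reflexivity.
Qed.

Lemma val_succ (n : N) : succ (val n) = val (plus n one).
Proof. simpl. rewrite padd_S, padd_0 by auto using val_omega, omega_0. reflexivity. Qed.

Add Ring N_ring : N_semiring.
Local Infix "+" := plus.
Local Infix "*" := times.

Lemma N_case (n : N) : n = zero \/ exists m, n = m + one.
Proof.
  destruct (omega_case (val n) (val_omega n)) as [H|(m & Hm & H)].
  - left. now apply val_inj.
  - right. destruct (val_surj m Hm) as (k & ->). exists k. apply val_inj.
    now rewrite H, val_succ.
Qed.

(** Order is expressed by a difference, so that an inequality is proved by naming the difference and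
    calling [ring]. *)
Definition lt (m n : N) : Prop := exists k, n = m + k + one.
Definition le (m n : N) : Prop := exists k, n = m + k.

Lemma plus_cancel (m n k : N) : m + k = n + k -> m = n.
Proof.
  intro H. apply val_inj. apply (f_equal val) in H. simpl in H.
  revert H. generalize (val_omega k). generalize (val k).
  oind; [dfn| |].
  - now rewrite !padd_0 by apply val_omega.
  - intros l Hl IH E. rewrite !padd_S in E by auto using val_omega.
    apply IH. now apply succ_inj.
Qed.

Lemma plus_one_nonzero (m : N) : m + one <> zero.
Proof. intro H. apply (f_equal val) in H. rewrite <- val_succ in H. now apply succ_nonempty in H. Qed.

Lemma lt_irrefl (m : N) : ~ lt m m.
Proof.
  intros (k & H). apply (plus_one_nonzero k). symmetry. apply (plus_cancel _ _ m).
  transitivity m; [ring|]. rewrite H at 1. ring.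
Qed.

Lemma le_or_lt (m n : N) : le m n \/ lt n m.
Proof.
  (* Internal induction needs a definable predicate, hence a statement quantifying over elements of
     [omega] in place of the type [N]. *)
  assert (K : forall n : M, n ∈ omega -> forall m, m ∈ omega ->
    (exists k, k ∈ omega /\ n = padd m k) \/ (exists k, k ∈ omega /\ m = padd n (succ k))).
  { oind; [dfn| |].
    - intros x Hx. destruct (omega_case x Hx) as [->|(y & Hy & ->)].
      + left. exists empty. split; [apply omega_0|]. now rewrite padd_0.
      + right. exists y. split; [exact Hy|]. now rewrite padd_0l by now apply omega_S.
    - intros y Hy IH x Hx. destruct (IH x Hx) as [(k & Hk & ->)|(k & Hk & ->)].
      + left. exists (succ k). split; [now apply omega_S|]. now rewrite padd_S.
      + destruct (omega_case k Hk) as [->|(j & Hj & ->)].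
        * left. exists empty. split; [apply omega_0|].
          rewrite padd_0 by auto. now rewrite padd_S, padd_0 by auto using omega_0.
        * right. exists j. split; [exact Hj|]. now rewrite padd_Sl, padd_S by auto using omega_S. }
  destruct (K (val n) (val_omega n) (val m) (val_omega m)) as [(k & Hk & E)|(k & Hk & E)];
    destruct (val_surj k Hk) as (l & ->); [left|right]; exists l; apply val_inj.
  - exact E.
  - rewrite E, val_succ. change (val (n + (l + one)) = val (n + l + one)). f_equal. ring.
Qed.

(** Identifies membership, the order used by the definitions, with the order by differences. From
    [lt] to membership one inducts on the difference; the converse follows from linearity, since
    foundation forbids [n <= m] when [m] is a member of [n]. *)
Lemma mem_lt (m n : N) : val m ∈ val n <-> lt m n.
Proof.
  assert (K : forall (m : N) (k : M), k ∈ omega -> val m ∈ padd (val m) (succ k)).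
  { intro l. oind; [dfn| |].
    - rewrite padd_S, padd_0 by auto using val_omega, omega_0. apply in_succ. auto.
    - intros k Hk H. rewrite padd_S by auto using val_omega, omega_S. apply in_succ. auto. }
  assert (L : lt m n -> val m ∈ val n).
  { intros (k & ->). replace (m + k + one) with (m + (k + one)) by ring.
    simpl plus. change (val m ∈ padd (val m) (val (k + one))). rewrite <- val_succ.
    apply K, val_omega. }
  split; [|exact L]. intro H.
  destruct (le_or_lt n m) as [(k & ->)|A]; [|exact A]. exfalso.
  destruct (N_case k) as [->|(j & ->)].
  - replace (n + zero) with n in H by ring. now apply mem_irrefl in H.
  - apply (mem_asym _ _ H).
    change (val n ∈ padd (val n) (val (j + one))). rewrite <- val_succ. apply K, val_omega.
Qed.

Lemma le_eq_or_lt (m n : N) : le m n -> m = n \/ lt m n.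
Proof.
  intros (k & ->). destruct (N_case k) as [->|(j & ->)].
  - left. ring.
  - right. exists j. ring.
Qed.

End Naturals.

(** * Finite and countable sets *)

Section FiniteSets.
Context {M : ZF_model}.
Implicit Types a b c f g h i j k m n x y z A B C S X : M.

Lemma omega_total m n : m ∈ omega -> n ∈ omega -> m ∈ n \/ m = n \/ n ∈ m.
Proof.
  intros Hm Hn. destruct (val_surj m Hm) as (m' & ->), (val_surj n Hn) as (n' & ->).
  rewrite !mem_lt. destruct (le_or_lt m' n') as [H|H]; [|auto].
  destruct (le_eq_or_lt m' n' H) as [->|]; auto.
Qed.

Lemma equipollent_intro A B (R : M -> M -> Prop) :
  definable (fun v => R (v 0) (v 1)) ->
  (forall a, a ∈ A -> exists b, b ∈ B /\ R a b) ->
  (forall b, b ∈ B -> exists a, a ∈ A /\ R a b) ->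
  (forall a b c, a ∈ A -> b ∈ B -> c ∈ B -> R a b -> R a c -> b = c) ->
  (forall a b c, a ∈ A -> b ∈ A -> c ∈ B -> R a c -> R b c -> a = b) ->
  equipollent A B.
Proof.
  intros D H K U I. exists (graph A B R). split; [now apply graph_maps|].
  intros b Hb. destruct (K b Hb) as (a & Ha & Rab). exists a. split.
  - apply in_graph; auto.
  - intros c Hc. apply in_graph in Hc; [|exact D]. destruct Hc as (Hc & _ & Rcb).
    now apply (I a c b).
Qed.

Lemma bijection_inj f A B a c b : bijection f A B -> pair a b ∈ f -> pair c b ∈ f -> a = c.
Proof.
  intros ((Hs & _) & H) Ha Hc. pose proof (Hs _ Ha) as K. apply in_prod_pair in K.
  destruct (H b) as (d & _ & U); [tauto|]. rewrite <- (U a Ha). auto.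
Qed.

Lemma bijection_dom f A B a b : bijection f A B -> pair a b ∈ f -> a ∈ A /\ b ∈ B.
Proof. intros ((Hs & _) & _) H. now apply Hs, in_prod_pair in H. Qed.

Lemma definable_bijection (s t u : (nat -> M) -> M) :
  defterm s -> defterm t -> defterm u -> definable (fun v => bijection (s v) (t v) (u v)).
Proof.
  apply (definable_subst3 bijection). unfold bijection, maps, subset, unique. dfn.
Qed.

Lemma definable_equipollent (s t : (nat -> M) -> M) :
  defterm s -> defterm t -> definable (fun v => equipollent (s v) (t v)).
Proof.
  apply (definable_subst2 equipollent). unfold equipollent.
  apply definable_exists, definable_bijection; dfn.
Qed.

Lemma definable_finite (s : (nat -> M) -> M) :
  defterm s -> definable (fun v => finite (s v)).
Proof.
  apply (definable_subst1 finite). unfold finite.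
  apply definable_exists, definable_and; [dfn|]. apply definable_equipollent; dfn.
Qed.

Lemma finite_omega n : n ∈ omega -> finite n.
Proof.
  intro Hn. exists n. split; [exact Hn|].
  apply equipollent_intro with (fun x y => x = y); [dfn|eauto|eauto|..]; intros; congruence.
Qed.

Lemma finite_empty : finite (empty : M).
Proof. apply finite_omega, omega_0. Qed.

Lemma union_single_eq A x : x ∈ A -> union A (single x) = A.
Proof.
  intro H. apply zf_extensionality. intro y. rewrite in_union, in_single.
  split; [|tauto]. intros [K| ->]; auto.
Qed.

Lemma finite_add A x : finite A -> finite (union A (single x)).
Proof.
  intros HA. destruct (classic (x ∈ A)) as [Hx|Hx]; [now rewrite union_single_eq|].
  destruct HA as (n & Hn & f & Hf). exists (succ n). split; [now apply omega_S|].
  pose proof (fun a b => bijection_dom f A n a b Hf) as Dm.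
  (* [x] goes to [n], the new element of [succ n]. Clashes between the two clauses are excluded
     because [x] is outside [A] and [n] is not a member of itself. *)
  apply equipollent_intro with (fun a b => (a = x /\ b = n) \/ pair a b ∈ f); [dfn|..].
  - intros a Ha. apply in_union in Ha. rewrite in_single in Ha. destruct Ha as [Ha| ->].
    + destruct (maps_unique f A n a) as (b & Hb & K); [apply Hf|exact Ha|].
      exists b. rewrite in_succ, K. auto.
    + exists n. rewrite in_succ. auto.
  - intros b Hb. apply in_succ in Hb. destruct Hb as [Hb| ->].
    + destruct Hf as (_ & Hf). destruct (Hf b Hb) as (a & Ha & _). exists a.
      rewrite in_union. split; [left|]; [now apply Dm in Ha|auto].
    + exists x. rewrite in_union, in_single. auto.
  - intros a b c _ _ _ [(-> & ->)|H] [(E & ->)|K]; auto.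
    + now apply Dm in K.
    + subst a. now apply Dm in H.
    + destruct (maps_unique f A n a) as (d & _ & L); [apply Hf|now apply Dm in H|].
      apply L in H, K. congruence.
  - intros a b c _ _ _ [(-> & ->)|H] [(-> & E)|K]; auto.
    + apply Dm in K. now destruct (mem_irrefl n).
    + subst c. apply Dm in H. now destruct (mem_irrefl n).
    + now apply (bijection_inj f A n a b c).
Qed.

(** Internal induction on the cardinal, for all sets of that cardinal at once; the point taken out
    of a set equipollent with [succ n] is the one matched with [n]. *)
Lemma finite_ind (P : M -> Prop) : definable (fun v => P (v 0)) -> P empty ->
  (forall A x, finite A -> P A -> P (union A (single x))) ->
  forall A, finite A -> P A.
Proof.
  intros D P0 PS.
  assert (K : forall n, n ∈ omega -> forall A, equipollent A n -> P A).
  { oind; [apply definable_forall, definable_imp; [apply definable_equipollent; dfn|dfn]| |].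
    - intros A (f & Hf & _). replace A with (empty : M); [exact P0|].
      apply zf_extensionality. intro x. split; intro H; [now apply in_empty in H|].
      apply (maps_ap_in f A empty x Hf) in H. now apply in_empty in H.
    - intros n Hn IH A (f & Hf).
      assert (E : exists! x, pair x n ∈ f) by (apply Hf, in_succ; auto).
      destruct E as (x & Hx & U).
      pose proof (bijection_dom _ _ _ _ _ Hf Hx) as (Ax & _).
      set (A' := sep A (fun y => y <> x)).
      assert (HA' : forall y, y ∈ A' <-> y ∈ A /\ y <> x) by (intro y; refine (in_sep _ _ _ y); dfn).
      replace A with (union A' (single x)).
      2:{ apply zf_extensionality. intro y. rewrite in_union, in_single, HA'.
          destruct (classic (y = x)) as [->|]; tauto. }
      assert (EA : equipollent A' n).
      { apply equipollent_intro with (fun a b => pair a b ∈ f); [dfn|..].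
        - intros a Ha. apply HA' in Ha. destruct Ha as (Ha & Na).
          destruct (maps_unique f A (succ n) a) as (b & Hb & L); [apply Hf|exact Ha|].
          exists b. rewrite L. split; [|reflexivity]. apply in_succ in Hb.
          destruct Hb as [Hb| ->]; [exact Hb|]. destruct Na. symmetry. apply U. now apply L.
        - intros b Hb. destruct Hf as (Hf1 & Hf2).
          destruct (Hf2 b) as (a & Ha & _); [apply in_succ; auto|]. exists a. split; [|exact Ha].
          apply HA'. split; [now apply (maps_dom f A (succ n) a b)|]. intros ->.
          destruct (maps_unique f A (succ n) x Hf1 Ax) as (d & _ & L). apply L in Ha, Hx. rewrite Ha, <- Hx in Hb.
            now apply (mem_irrefl n).
        - intros a b c Ha _ _ H K. apply HA' in Ha.
          destruct (maps_unique f A (succ n) a) as (d & _ & L); [apply Hf|apply Ha|].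
          apply L in H, K. congruence.
        - intros a b c _ _ _ H K. now apply (bijection_inj f A (succ n) a b c). }
      apply PS; [now exists n|now apply IH]. }
  intros A (n & Hn & E). eauto.
Qed.

Lemma finite_subset A B : finite A -> subset B A -> finite B.
Proof.
  intro HA. revert A HA B.
  refine (finite_ind (fun A => forall B, subset B A -> finite B) _ _ _).
  - unfold subset. apply definable_forall, definable_imp; [dfn|apply definable_finite; dfn].
  - intros B H. replace B with (empty : M); [apply finite_empty|].
    apply subset_antisym; [|exact H]. intros x Hx. now apply in_empty in Hx.
  - intros A x HA IH B H.
    set (B' := sep B (fun y => y <> x)).
    assert (HB' : forall y, y ∈ B' <-> y ∈ B /\ y <> x) by (intro y; refine (in_sep _ _ _ y); dfn).
    assert (F : finite B').
    { apply IH. intros y Hy. apply HB' in Hy. destruct Hy as (Hy & N).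
      apply H, in_union in Hy. rewrite in_single in Hy. tauto. }
    destruct (classic (x ∈ B)) as [Hx|Hx].
    + replace B with (union B' (single x)); [now apply finite_add|].
      apply zf_extensionality. intro y. rewrite in_union, in_single, HB'.
      destruct (classic (y = x)) as [->|]; tauto.
    + replace B with B'; [exact F|]. apply zf_extensionality. intro y. rewrite HB'.
      split; [tauto|]. intro Hy. split; [exact Hy|]. now intros ->.
Qed.

Lemma finite_union A B : finite A -> finite B -> finite (union A B).
Proof.
  intro HA. revert B. refine (finite_ind (fun B => finite (union A B)) _ _ _).
  - apply definable_finite. dfn.
  - apply finite_subset with A; [exact HA|]. intros x Hx. apply in_union in Hx.
    destruct Hx as [Hx|Hx]; [exact Hx|now apply in_empty in Hx].
  - intros B x _ IH. apply finite_subset with (union (union A B) (single x)); [now apply finite_add|].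
    intros y. rewrite !in_union. tauto.
Qed.

(** Stated for any set covered by the values of [F], so that the image itself never has to be formed
    by replacement. *)
Lemma finite_image A (F : M -> M) : defterm (fun v => F (v 0)) -> finite A ->
  forall B, (forall y, y ∈ B -> exists x, x ∈ A /\ y = F x) -> finite B.
Proof.
  intros D HA. revert A HA.
  refine (finite_ind
    (fun A => forall B, (forall y, y ∈ B -> exists x, x ∈ A /\ y = F x) -> finite B) _ _ _).
  - apply definable_forall, definable_imp; [dfn|apply definable_finite; dfn].
  - intros B H. apply finite_subset with empty; [apply finite_empty|].
    intros y Hy. destruct (H y Hy) as (x & Hx & _). now apply in_empty in Hx.
  - intros A x HA IH B H.
    apply finite_subset with (union (sep B (fun y => y <> F x)) (single (F x))).
    + apply finite_add, IH. intros y Hy. apply in_sep in Hy; [|dfn].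
      destruct Hy as (Hy & N). destruct (H y Hy) as (z & Hz & E). exists z.
      apply in_union in Hz. rewrite in_single in Hz. split; [|exact E].
      destruct Hz as [Hz| ->]; [exact Hz|contradiction].
    + intros y Hy. rewrite in_union, in_single, in_sep by dfn.
      destruct (classic (y = F x)); tauto.
Qed.

Lemma finite_prod A B : finite A -> finite B -> finite (prod A B).
Proof.
  intros HA HB. revert A HA. refine (finite_ind (fun A => finite (prod A B)) _ _ _).
  - apply definable_finite. dfn.
  - apply finite_subset with empty; [apply finite_empty|]. intros p Hp.
    apply in_prod in Hp. destruct Hp as (a & b & Ha & _). now apply in_empty in Ha.
  - intros A x _ IH.
    apply finite_subset with (union (prod A B) (prod (single x) B)).
    + apply finite_union; [exact IH|]. apply (finite_image B (fun y => pair x y)); [dfn|exact HB|].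
      intros p Hp. apply in_prod in Hp. destruct Hp as (a & b & Ha & Hb & ->).
      apply in_single in Ha. subst. eauto.
    + intros p Hp. apply in_prod in Hp. destruct Hp as (a & b & Ha & Hb & ->).
      apply in_union in Ha. apply in_union. rewrite !in_prod_pair. tauto.
Qed.

(** A subset that contains the added point [x] arises from a subset of [A] by adjoining [x], so each
    step adds one image of the previous powerset. This serves to bound the set of enumerations of a
    finite fibre. *)
Lemma finite_powerset A : finite A -> finite (powerset A).
Proof.
  revert A. refine (finite_ind (fun A => finite (powerset A)) _ _ _).
  - apply definable_finite. dfn.
  - apply finite_subset with (single empty).
    + apply finite_subset with (union empty (single empty)); [apply finite_add, finite_empty|].
      intro x. rewrite in_union. tauto.
    + intros B HB. apply in_powerset in HB. apply in_single. apply subset_antisym; [exact HB|].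
      intros x Hx. now apply in_empty in Hx.
  - intros A x _ IH.
    set (Q := sep (powerset (union A (single x))) (fun B => x ∈ B)).
    apply finite_subset with (union (powerset A) Q).
    + apply finite_union; [exact IH|].
      apply (finite_image (powerset A) (fun B => union B (single x))); [dfn|exact IH|].
      intros B HB. apply in_sep in HB; [|dfn]. destruct HB as (HB & Hx).
      apply in_powerset in HB. exists (sep B (fun y => y <> x)). split.
      * apply in_powerset. intros y Hy. apply in_sep in Hy; [|dfn]. destruct Hy as (Hy & N).
        apply HB, in_union in Hy. rewrite in_single in Hy. tauto.
      * apply zf_extensionality. intro y. rewrite in_union, in_single, in_sep by dfn.
        destruct (classic (y = x)) as [->|]; tauto.
    + intros B HB. apply in_union. destruct (classic (x ∈ B)) as [Hx|Hx].
      * right. apply in_sep; [dfn|]. auto.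
      * left. apply in_powerset in HB. apply in_powerset. intros y Hy.
        pose proof (HB y Hy) as K. apply in_union in K. rewrite in_single in K.
        destruct K as [K| ->]; [exact K|contradiction].
Qed.

Lemma least_unique (P : M -> Prop) m n : m ∈ omega -> n ∈ omega ->
  P m -> (forall k, k ∈ m -> ~ P k) -> P n -> (forall k, k ∈ n -> ~ P k) -> m = n.
Proof.
  intros Hm Hn Pm Lm Pn Ln. destruct (omega_total m n Hm Hn) as [H|[H|H]]; [|exact H|].
  - now destruct (Ln m H).
  - now destruct (Lm n H).
Qed.

(** [R] may attach several codes to one element; keeping only the least code gives an injection
    without any choice. *)
Lemma countable_intro A (R : M -> M -> Prop) : definable (fun v => R (v 0) (v 1)) ->
  (forall a, a ∈ A -> exists n, n ∈ omega /\ R a n) ->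
  (forall a b n, a ∈ A -> b ∈ A -> n ∈ omega -> R a n -> R b n -> a = b) ->
  countable A.
Proof.
  intros D H I.
  set (R' := fun a n => R a n /\ forall m, m ∈ n -> ~ R a m).
  assert (D' : definable (fun v => R' (v 0) (v 1))) by (unfold R'; dfn).
  set (S := sep omega (fun n => exists a, a ∈ A /\ R' a n)).
  assert (HS : forall n, n ∈ S <-> n ∈ omega /\ exists a, a ∈ A /\ R' a n)
    by (intro n; refine (in_sep _ _ _ n); dfn).
  exists S. split; [intros n Hn; now apply HS in Hn|].
  apply equipollent_intro with R'; [exact D'|..].
  - intros a Ha. destruct (omega_least (R a)) as (n & Hn & Ran & L); [dfn|auto|].
    exists n. assert (R' a n) by now split. rewrite HS. eauto.
  - intros n Hn. now apply HS in Hn.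
  - intros a m n _ Hm Hn (Pm & Lm) (Pn & Ln). apply HS in Hm, Hn.
    apply (least_unique (R a)); tauto.
  - intros a b n Ha Hb Hn (Ra & _) (Rb & _). apply HS in Hn. apply (I a b n); tauto.
Qed.

Lemma countable_injection A : countable A -> exists h, maps h A omega /\
  forall a b, a ∈ A -> b ∈ A -> ap h a = ap h b -> a = b.
Proof.
  intros (S & HS & f & Hf & If). exists f.
  assert (K : maps f A omega).
  { destruct Hf as (Hs & Hf). split; [|exact Hf]. intros p Hp. apply Hs, in_prod in Hp.
    destruct Hp as (a & b & Ha & Hb & ->). apply in_prod_pair. auto. }
  split; [exact K|]. intros a b Ha Hb E.
  apply (bijection_inj f A S a b (ap f a)); [now split| |].
  - now apply (maps_ap f A S).
  - rewrite E. now apply (maps_ap f A S).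
Qed.

Lemma finite_preimages h X : maps h X omega ->
  (forall n, n ∈ omega -> finite (sep X (fun x => ap h x = n))) ->
  forall n, n ∈ omega -> finite (sep X (fun x => ap h x ∈ n)).
Proof.
  intros Hh F. oind; [apply definable_finite; dfn| |].
  - apply finite_subset with empty; [apply finite_empty|]. intros x Hx.
    apply in_sep in Hx; [|dfn]. destruct Hx as (_ & Hx). now apply in_empty in Hx.
  - intros n Hn IH. apply finite_subset with (union (sep X (fun x => ap h x ∈ n)) (sep X (fun x => ap h x = n))).
    + apply finite_union; auto.
    + intros x Hx. apply in_sep in Hx; [|dfn]. rewrite in_union, !in_sep by dfn.
      rewrite in_succ in Hx. tauto.
Qed.

End FiniteSets.

(** * Rational and real numbers *)

Section Rationals.
Context {M : ZF_model}.
Notation N := (@N M).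
Implicit Types a b c k m n : N.
Implicit Types p q r s x y : M.

Add Ring N_ring : (@N_semiring M).
Local Infix "+" := plus.
Local Infix "*" := times.

Lemma lt_cancel a b c : lt (a + c) (b + c) -> lt a b.
Proof.
  intros (k & H). exists k. apply (plus_cancel _ _ c). rewrite H. ring.
Qed.

Lemma lt_le_trans a b c : lt a b -> le b c -> lt a c.
Proof. intros (k & ->) (l & ->). exists (k + l). ring. Qed.

Lemma lt_trans a b c : lt a b -> lt b c -> lt a c.
Proof. intros (k & ->) (l & ->). exists (k + l + one). ring. Qed.

Lemma lt_plus a b c d : lt a b -> lt c d -> lt (a + c) (b + d).
Proof. intros (k & ->) (l & ->). exists (k + l + one). ring. Qed.

Lemma lt_plus_l a b c : lt a b -> lt (a + c) (b + c).
Proof. intros (k & ->). exists k. ring. Qed.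

Lemma lt_times a b c : lt a b -> lt (a * (c + one)) (b * (c + one)).
Proof. intros (k & ->). exists (k * (c + one) + c). ring. Qed.

Lemma le_zero a : le zero a.
Proof. exists a. ring. Qed.

Lemma le_times a b c : le a b -> le (a * c) (b * c).
Proof. intros (k & ->). exists (k * c). ring. Qed.

Lemma not_lt_of_le a b : le a b -> ~ lt b a.
Proof. intros H K. apply (lt_irrefl b). now apply lt_le_trans with a. Qed.

Lemma lt_times_cancel a b c : lt (a * (c + one)) (b * (c + one)) -> lt a b.
Proof.
  intro H. destruct (le_or_lt b a) as [K|K]; [|exact K].
  now destruct (not_lt_of_le _ _ (le_times _ _ (c + one) K)).
Qed.

(* [fr a b c] represents the rational [(a - b) / (c + 1)]. *)
Definition fr a b c : M := frac (val a) (val b) (val (c + one)).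

Lemma fr_inj a b c a' b' c' : fr a b c = fr a' b' c' -> a = a' /\ b = b' /\ c = c'.
Proof.
  unfold fr, frac. rewrite !pair_inj. intros ((Ha & Hb) & Hc). apply val_inj in Ha, Hb, Hc.
  repeat split; auto. now apply plus_cancel with one.
Qed.

Lemma is_frac_fr a b c : is_frac (fr a b c) (val a) (val b) (val (c + one)).
Proof.
  repeat split; try apply val_omega. rewrite <- val_succ. apply succ_nonempty.
Qed.

Lemma is_frac_inv q (x y z : M) : is_frac q x y z ->
  exists a b c, x = val a /\ y = val b /\ z = val (c + one) /\ q = fr a b c.
Proof.
  intros (Hx & Hy & Hz & Nz & E). destruct (val_surj x Hx) as (a & ->).
  destruct (val_surj y Hy) as (b & ->). destruct (val_surj z Hz) as (c & ->).
  destruct (N_case c) as [->|(d & ->)]; [now destruct Nz|]. now exists a, b, d.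
Qed.

Lemma is_rat_fr q : is_rat q <-> exists a b c, q = fr a b c.
Proof.
  split.
  - intros (x & y & z & H). apply is_frac_inv in H.
    destruct H as (a & b & c & _ & _ & _ & E). eauto.
  - intros (a & b & c & ->). exists (val a), (val b), (val (c + one)). apply is_frac_fr.
Qed.

Lemma is_frac_fr_inv a b c (x y z : M) : is_frac (fr a b c) x y z ->
  x = val a /\ y = val b /\ z = val (c + one).
Proof.
  intro H. apply is_frac_inv in H. destruct H as (a' & b' & c' & -> & -> & -> & E).
  apply fr_inj in E. now destruct E as (-> & -> & ->).
Qed.

Lemma nat_add_val m n : nat_add (val m) (val n) = val (m + n).
Proof. apply nat_add_padd; apply val_omega. Qed.

Lemma nat_mul_val m n : nat_mul (val m) (val n) = val (m * n).
Proof. apply nat_mul_pmul; apply val_omega. Qed.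

Lemma rat_lt_fr a b c a' b' c' : rat_lt (fr a b c) (fr a' b' c') <->
  lt (a * (c' + one) + b' * (c + one)) (a' * (c + one) + b * (c' + one)).
Proof.
  rewrite <- mem_lt. split.
  - intros (x & y & z & x' & y' & z' & H & H' & K). apply is_frac_fr_inv in H, H'.
    destruct H as (-> & -> & ->), H' as (-> & -> & ->).
    rewrite !nat_mul_val, !nat_add_val in K. exact K.
  - intro K. exists (val a), (val b), (val (c + one)), (val a'), (val b'), (val (c' + one)).
    split; [apply is_frac_fr|]. split; [apply is_frac_fr|].
    rewrite !nat_mul_val, !nat_add_val. exact K.
Qed.

Lemma rat_lt_rat p q : rat_lt p q -> is_rat p /\ is_rat q.
Proof. intros (a & b & c & a' & b' & c' & H & K & _). unfold is_rat. eauto 10. Qed.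

Lemma rat_add_fr a b c a' b' c' : rat_add (fr a b c) (fr a' b' c') =
  fr (a * (c' + one) + a' * (c + one)) (b * (c' + one) + b' * (c + one)) (c * c' + c + c').
Proof.
  assert (E : (c + one) * (c' + one) = c * c' + c + c' + one) by ring.
  unfold rat_add. apply the_eq.
  - exists (val a), (val b), (val (c + one)), (val a'), (val b'), (val (c' + one)).
    split; [apply is_frac_fr|]. split; [apply is_frac_fr|].
    rewrite !nat_mul_val, !nat_add_val, E. reflexivity.
  - intros r (x & y & z & x' & y' & z' & H & H' & K). apply is_frac_fr_inv in H, H'.
    destruct H as (-> & -> & ->), H' as (-> & -> & ->).
    rewrite !nat_mul_val, !nat_add_val, E in K. exact K.
Qed.

Lemma definable_is_rat (t : (nat -> M) -> M) :
  defterm t -> definable (fun v => is_rat (t v)).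
Proof. apply (definable_subst1 is_rat). unfold is_rat, is_frac, frac. dfn. Qed.

Lemma definable_rat_lt (s t : (nat -> M) -> M) :
  defterm s -> defterm t -> definable (fun v => rat_lt (s v) (t v)).
Proof.
  apply (definable_subst2 rat_lt).
  (* On the entries of a fraction, which lie in [omega], the descriptions [nat_add] and [nat_mul]
     may be replaced by their definable twins. *)
  apply definable_ext with (fun v => exists a b c a' b' c' : M,
    is_frac (v 0) a b c /\ is_frac (v 1) a' b' c' /\
    padd (pmul a c') (pmul b' c) ∈ padd (pmul a' c) (pmul b c')).
  - unfold is_frac, frac. dfn.
  - intro v. unfold rat_lt.
    assert (K : forall (a b c a' b' c' : M), is_frac (v 0) a b c -> is_frac (v 1) a' b' c' ->
      padd (pmul a c') (pmul b' c) = nat_add (nat_mul a c') (nat_mul b' c) /\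
      padd (pmul a' c) (pmul b c') = nat_add (nat_mul a' c) (nat_mul b c')).
    { intros a b c a' b' c' (H1 & H2 & H3 & _) (H4 & H5 & H6 & _).
      rewrite !nat_mul_pmul, !nat_add_padd by auto using pmul_in. auto. }
    split; intros (a & b & c & a' & b' & c' & H & H' & L);
      destruct (K a b c a' b' c' H H') as (E & E'); exists a, b, c, a', b', c'.
    + rewrite <- E, <- E'. auto.
    + rewrite E, E'. auto.
Qed.

Definition rats : M := sep (prod (prod omega omega) omega) is_rat.

Lemma in_rats q : q ∈ rats <-> is_rat q.
Proof.
  unfold rats. rewrite in_sep by (apply definable_is_rat; dfn).
  split; [tauto|]. intro H. split; [|exact H]. destruct H as (a & b & c & H1 & H2 & H3 & _ & ->).
  apply in_prod_pair. split; [apply in_prod_pair; auto|exact H3].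
Qed.

Lemma definable_is_real (t : (nat -> M) -> M) : defterm t -> definable (fun v => is_real (t v)).
Proof.
  apply (definable_subst1 is_real).
  assert (D : definable (fun v : nat -> M => rat_lt (v 0) (v 1))) by (apply definable_rat_lt; dfn).
  assert (D' : definable (fun v : nat -> M => is_rat (v 0))) by (apply definable_is_rat; dfn).
  unfold is_real. dfn.
Qed.

Lemma in_reals x : x ∈ reals <-> is_real x.
Proof.
  unfold reals. refine (setof_bounded _ (powerset rats) _ _ x).
  - apply definable_is_real. dfn.
  - intros y (H & _). apply in_powerset. intros q Hq. now apply in_rats, H.
Qed.

(* The real number [k], for [k] in [omega]. *)
Definition nreal (k : M) : M :=
  sep rats (fun q => exists a b c : M, is_frac q a b c /\ a ∈ padd b (pmul k c)).

Lemma defterm_nreal (s : (nat -> M) -> M) : defterm s -> defterm (fun v => nreal (s v)).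
Proof. apply (defterm_subst1 nreal). unfold nreal, is_frac, frac. dfn. Qed.

Lemma in_nreal q k : q ∈ nreal (val k) <->
  exists a b c, q = fr a b c /\ lt a (b + k * (c + one)).
Proof.
  unfold nreal. rewrite in_sep by (unfold is_frac, frac; dfn). rewrite in_rats. split.
  - intros (_ & x & y & z & H & L). apply is_frac_inv in H.
    destruct H as (a & b & c & -> & -> & -> & ->). exists a, b, c. split; [reflexivity|].
    apply mem_lt. exact L.
  - intros (a & b & c & -> & L). split; [apply is_rat_fr; eauto|].
    exists (val a), (val b), (val (c + one)). split; [apply is_frac_fr|].
    apply mem_lt in L. exact L.
Qed.

Lemma fr_in_nreal a b c k : fr a b c ∈ nreal (val k) <-> lt a (b + k * (c + one)).
Proof.
  rewrite in_nreal. split; [|eauto].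
  intros (a' & b' & c' & E & L). apply fr_inj in E. now destruct E as (-> & -> & ->).
Qed.

Lemma nreal_down p q k : q ∈ nreal (val k) -> rat_lt p q -> p ∈ nreal (val k).
Proof.
  intros Hq Hpq. apply in_nreal in Hq. destruct Hq as (a' & b' & c' & -> & L).
  destruct (rat_lt_rat _ _ Hpq) as (Hp & _). apply is_rat_fr in Hp.
  destruct Hp as (a & b & c & ->). apply rat_lt_fr in Hpq. apply fr_in_nreal.
  apply lt_times_cancel with c'. apply lt_cancel with (b' * (c + one)).
  eapply lt_trans; [exact Hpq|]. apply (lt_times _ _ c) in L.
  apply (lt_plus_l _ _ (b * (c' + one))) in L.
  replace ((b + k * (c + one)) * (c' + one) + b' * (c + one)) with
    ((b' + k * (c' + one)) * (c + one) + b * (c' + one)) by ring. exact L.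
Qed.

Lemma nreal_is_real k : is_real (nreal (val k)).
Proof.
  split; [|split; [|split; [|split]]].
  - intros q H. apply in_nreal in H. destruct H as (a & b & c & -> & _). apply is_rat_fr. eauto.
  (* The rational -1 lies below every natural number; the next witness is the rational [k], which is
     not below itself. *)
  - exists (fr zero one zero). apply fr_in_nreal. exists (k * (zero + one)). ring.
  - exists (fr k zero zero). split; [apply is_rat_fr; eauto|]. rewrite fr_in_nreal. intro H.
    apply (lt_irrefl k). replace (zero + k * (zero + one)) with k in H by ring. exact H.
  - intros p q. apply nreal_down.
  - intros p H. apply in_nreal in H. destruct H as (a & b & c & -> & (l & L)).
    (* This is the given rational plus 1/(2(c+1)). It stays below [k] because numerators are
       integers: the distance to [k] was at least 1/(c+1). *)
    exists (fr (a + a + one) (b + b) (c + c + one)). rewrite fr_in_nreal, rat_lt_fr. split.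
    + exists (l + l). transitivity ((b + k * (c + one)) + (b + k * (c + one))); [ring|].
      rewrite L. ring.
    + exists c. ring.
Qed.

Lemma nreal_zero : nreal empty = real_zero.
Proof.
  symmetry. apply setof_eq. intro q. change (empty : M) with (val (@zero M)). rewrite in_nreal. split.
  - intros (a & b & c & -> & L). exists (val a), (val b), (val (c + one)).
    split; [apply is_frac_fr|]. apply mem_lt.
    replace b with (b + zero * (c + one)) by ring. exact L.
  - intros (x & y & z & H & L). apply is_frac_inv in H.
    destruct H as (a & b & c & -> & -> & -> & ->). exists a, b, c. split; [reflexivity|].
    apply mem_lt in L. replace (b + zero * (c + one)) with b by ring. exact L.
Qed.

Lemma nreal_le m n : real_le (nreal (val m)) (nreal (val n)) <-> le m n.
Proof.
  split.
  - intro H. destruct (le_or_lt m n) as [K|K]; [exact K|]. destruct (lt_irrefl n).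
    assert (L : fr n zero zero ∈ nreal (val n)).
    { apply H, fr_in_nreal. replace (zero + m * (zero + one)) with m by ring. exact K. }
    apply fr_in_nreal in L. replace (zero + n * (zero + one)) with n in L by ring. exact L.
  - intros (k & ->) q H. apply in_nreal in H. destruct H as (a & b & c & -> & L).
    apply fr_in_nreal. eapply lt_le_trans; [exact L|]. exists (k * (c + one)). ring.
Qed.

Lemma nreal_inj m n : nreal (val m) = nreal (val n) -> m = n.
Proof.
  intro E. assert (H : le m n) by (apply nreal_le; rewrite E; now intro).
  assert (K : le n m) by (apply nreal_le; rewrite E; now intro).
  destruct (le_eq_or_lt m n H) as [L|L]; [exact L|]. now apply not_lt_of_le in K.
Qed.

(** A rational (a - b)/(c + 1) outside the cut is at most a. An element of the cut at or above a + 1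
    would therefore exceed that rational and pull it into the cut. *)
Lemma real_archimedean x : is_real x -> exists n, real_le x (nreal (val n)).
Proof.
  intros (Hr & _ & (q & Hq & Nq) & Dn & _). apply is_rat_fr in Hq.
  destruct Hq as (a & b & c & ->). exists (a + one). intros p Hp.
  destruct (proj1 (is_rat_fr p) (Hr p Hp)) as (a' & b' & c' & ->). apply fr_in_nreal.
  destruct (le_or_lt (b' + (a + one) * (c' + one)) a') as [(t & E)|L]; [|exact L].
  destruct Nq. apply Dn with (fr a' b' c'); [exact Hp|]. apply rat_lt_fr. rewrite E.
  exists (a * c * (c' + one) + c * (c' + one) + c' + t * (c + one) + b * (c' + one)). ring.
Qed.

Lemma in_real_add x y r : is_real x -> is_real y -> (r ∈ real_add x y <->
  exists p q, p ∈ x /\ q ∈ y /\ rat_lt r (rat_add p q)).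
Proof.
  intros Hx Hy. unfold real_add. refine (setof_bounded _ rats _ _ r).
  (* [rat_add] is a description, so its value [s] is spelled out as a fraction computed with [padd]
     and [pmul]. *)
  - apply definable_ext with (fun v => exists p q s a b c a' b' c' : M, p ∈ x /\ q ∈ y /\
      is_frac p a b c /\ is_frac q a' b' c' /\
      s = frac (padd (pmul a c') (pmul a' c)) (padd (pmul b c') (pmul b' c)) (pmul c c') /\
      rat_lt (v 0) s).
    + assert (D : definable (fun v : nat -> M => rat_lt (v 0) (v 1))) by (apply definable_rat_lt; dfn).
      unfold is_frac, frac. dfn.
    + assert (K : forall a b c a' b' c' : N, frac
        (padd (pmul (val a) (val (c' + one))) (pmul (val a') (val (c + one))))
        (padd (pmul (val b) (val (c' + one))) (pmul (val b') (val (c + one))))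
        (pmul (val (c + one)) (val (c' + one))) = rat_add (fr a b c) (fr a' b' c')).
      { intros a b c a' b' c'. rewrite rat_add_fr. unfold fr.
        replace (c * c' + c + c' + one) with ((c + one) * (c' + one)) by ring. reflexivity. }
      intro v. split.
      * intros (p & q & s & a & b & c & a' & b' & c' & Hp & Hq & F & F' & -> & L).
        exists p, q. split; [exact Hp|]. split; [exact Hq|].
        apply is_frac_inv in F, F'. destruct F as (A & B & C & -> & -> & -> & ->).
        destruct F' as (A' & B' & C' & -> & -> & -> & ->). rewrite K in L. exact L.
      * intros (p & q & Hp & Hq & L).
        destruct (proj1 (is_rat_fr p) (proj1 Hx p Hp)) as (a & b & c & ->).
        destruct (proj1 (is_rat_fr q) (proj1 Hy q Hq)) as (a' & b' & c' & ->).
        exists (fr a b c), (fr a' b' c'), (rat_add (fr a b c) (fr a' b' c')),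
          (val a), (val b), (val (c + one)), (val a'), (val b'), (val (c' + one)).
        rewrite K. repeat (split; [first [assumption|apply is_frac_fr|reflexivity]|]). exact L.
  - intros s (p & q & _ & _ & L). apply in_rats. now apply rat_lt_rat in L.
Qed.

Lemma real_add_mono x y x' y' : is_real x -> is_real y -> is_real x' -> is_real y' ->
  real_le x x' -> real_le y y' -> real_le (real_add x y) (real_add x' y').
Proof.
  intros Hx Hy Hx' Hy' H K r Hr. apply in_real_add in Hr; auto. apply in_real_add; auto.
  destruct Hr as (p & q & Hp & Hq & L). exists p, q. auto.
Qed.

Lemma nreal_add m n : real_add (nreal (val m)) (nreal (val n)) = nreal (val (m + n)).
Proof.
  apply zf_extensionality. intro r. rewrite in_real_add by apply nreal_is_real. split.
  - intros (p & q & Hp & Hq & L). apply nreal_down with (rat_add p q); [|exact L].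
    apply in_nreal in Hp, Hq. destruct Hp as (a & b & c & -> & Hp).
    destruct Hq as (a' & b' & c' & -> & Hq). rewrite rat_add_fr. apply fr_in_nreal.
    apply (lt_times _ _ c') in Hp. apply (lt_times _ _ c) in Hq.
    pose proof (lt_plus _ _ _ _ Hp Hq) as K.
    match type of K with lt _ ?r => match goal with |- lt _ ?s => replace s with r by ring end end.
    exact K.
  - intro H. apply in_nreal in H. destruct H as (a & b & c & -> & (l & L)).
    (* [r < m + n] forces [r <= m + n - 1/(c+1)], and [r] is below the sum of [m - 1/4(c+1)] and
       [n - 1/4(c+1)]. *)
    set (d := c + c + c + c + one + one + one).
    exists (fr (m * (d + one)) one d), (fr (n * (d + one)) one d).
    split; [apply fr_in_nreal; exists zero; ring|].
    split; [apply fr_in_nreal; exists zero; ring|].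
    rewrite rat_add_fr, rat_lt_fr.
    exists ((d + one) * (d + one) * l + (c + one) * (d + one) + c * (d + one) + d).
    transitivity ((d + one) * (d + one) * (b + (m + n) * (c + one))); [ring|].
    rewrite L. unfold d. ring.
Qed.

End Rationals.

(** * Metrics from finite-to-one maps *)

Ltac dfn_metrics :=
  lazymatch goal with
  | |- defterm (fun v => nreal _) => apply defterm_nreal
  | |- definable (fun v => bijection _ _ _) => apply definable_bijection
  | |- definable (fun v => equipollent _ _) => apply definable_equipollent
  | |- definable (fun v => finite _) => apply definable_finite
  end.
Ltac dfn_hook ::=
  first [ dfn_sets | dfn_relations | dfn_succ | dfn_arithmetic | dfn_metrics ].

Section Metrics.
Context {M : ZF_model}.
Notation N := (@N M).
Implicit Types a b c d f h p q r s x y z A B C X : M.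

Add Ring N_ring : (@N_semiring M).

(** The last hypothesis says that [r] is a union of cuts, which is how suprema appear among lower
    cuts; the bound provides a rational outside [r]. *)
Lemma real_sup (r : M) (n : N) : (exists q, q ∈ r) -> real_le r (nreal (val n)) ->
  (forall q, q ∈ r -> exists x, is_real x /\ q ∈ x /\ subset x r) -> is_real r.
Proof.
  intros Ne Bd H. split; [|split; [|split; [|split]]].
  - intros q Hq. destruct (H q Hq) as (x & Hx & K & _). now apply Hx.
  - exact Ne.
  - destruct (nreal_is_real n) as (_ & _ & (q & Hq & K) & _). exists q. split; auto.
  - intros p q Hq L. destruct (H q Hq) as (x & Hx & K & S). apply S.
    destruct Hx as (_ & _ & _ & Dn & _). eauto.
  - intros p Hp. destruct (H p Hp) as (x & Hx & K & S).
    destruct Hx as (_ & _ & _ & _ & O). destruct (O p K) as (q & Hq & L). eauto.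
Qed.

Lemma dist_ap X d x y : maps d (prod X X) reals -> x ∈ X -> y ∈ X ->
  dist d x y = ap d (pair x y).
Proof.
  intros Hd Hx Hy. apply (app_ap d (prod X X) reals); [exact Hd|]. now apply in_prod_pair.
Qed.

Lemma dist_real X d x y : maps d (prod X X) reals -> x ∈ X -> y ∈ X -> is_real (dist d x y).
Proof.
  intros Hd Hx Hy. rewrite (dist_ap X) by assumption. apply in_reals.
  apply (maps_ap_in d (prod X X)); [exact Hd|]. now apply in_prod_pair.
Qed.

(** The supremum is the union of the distances as cuts. [real_zero] is adjoined because the diameter
    is taken in [0, oo], so an empty [A] gets diameter 0. *)
Lemma has_diam_bounded X d A (n : N) : is_metric X d -> subset A X ->
  (forall x y, x ∈ A -> y ∈ A -> real_le (dist d x y) (nreal (val n))) ->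
  exists r, has_diam d A r.
Proof.
  intros (Hd & _) HA Bd.
  set (r := sep rats (fun q => q ∈ real_zero \/
    exists x y, x ∈ A /\ y ∈ A /\ q ∈ ap d (pair x y))).
  assert (Z : is_real (real_zero : M)).
  { rewrite <- nreal_zero. exact (nreal_is_real zero). }
  assert (Hr : forall q, q ∈ r <-> is_rat q /\ (q ∈ real_zero \/
    exists x y, x ∈ A /\ y ∈ A /\ q ∈ dist d x y)).
  { intro q. unfold r. rewrite in_sep by dfn. rewrite in_rats.
    split; intros (H & [K|(x & y & Hx & Hy & K)]); (split; [exact H|]); auto;
      right; exists x, y; rewrite (dist_ap X d x y Hd (HA x Hx) (HA y Hy)) in *; auto. }
  assert (Zr : subset real_zero r).
  { intros q Hq. apply Hr. split; [now apply Z|auto]. }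
  assert (Dr : forall x y, x ∈ A -> y ∈ A -> subset (dist d x y) r).
  { intros x y Hx Hy q Hq. apply Hr. split; [|eauto 6].
    apply (dist_real X d x y Hd); auto. }
  assert (R : is_real r).
  { apply (real_sup r n).
    - destruct Z as (_ & (q & Hq) & _). exists q. auto.
    - intros q Hq. apply Hr in Hq. destruct Hq as (_ & [Hq|(x & y & Hx & Hy & Hq)]).
      + rewrite <- nreal_zero in Hq. revert q Hq. apply (nreal_le zero n), le_zero.
      + now apply (Bd x y).
    - intros q Hq. apply Hr in Hq. destruct Hq as (_ & [Hq|(x & y & Hx & Hy & Hq)]); eauto.
      exists (dist d x y). split; [apply (dist_real X d x y Hd); auto|]. auto. }
  exists r. split.
  - split; [now apply in_reals|]. auto.
  - intros s (_ & Zs & Ds) q Hq. apply Hr in Hq.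
    destruct Hq as (_ & [Hq|(x & y & Hx & Hy & Hq)]); [now apply Zs|now apply (Ds x y)].
Qed.

Lemma in_FB X A : A ∈ FB X <-> subset A X /\ finite A.
Proof.
  unfold FB. refine (setof_bounded _ (powerset X) _ _ A).
  - unfold subset. dfn.
  - intros B (H & _). now apply in_powerset.
Qed.

Lemma finite_single x : finite (single x).
Proof.
  apply finite_subset with (union empty (single x)); [apply finite_add, finite_empty|].
  intro y. rewrite in_union. auto.
Qed.

Lemma in_ball X d x r y : maps d (prod X X) reals -> x ∈ X ->
  (y ∈ ball X d x r <-> y ∈ X /\ real_lt (dist d x y) r).
Proof.
  intros Hd Hx. unfold ball. refine (setof_spec _ _ y).
  exists (sep X (fun y => real_lt (ap d (pair x y)) r)). intro z.
  rewrite in_sep by (unfold real_lt, real_le, subset; dfn).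
  split; intros (Hz & K); (split; [exact Hz|]);
    rewrite (dist_ap X d x z Hd Hx Hz) in *; exact K.
Qed.

Lemma in_metric_bornology X d A : is_metric X d ->
  (A ∈ metric_bornology X d <-> subset A X /\ exists r, has_diam d A r).
Proof.
  intros (Hd & _). unfold metric_bornology. refine (setof_bounded _ (powerset X) _ _ A).
  2:{ intros B (H & _). now apply in_powerset. }
  (* A definable copy of the bound inside [has_diam]: on subsets of [X] the description [dist]
     agrees with [ap d]. *)
  set (bound := fun B s => s ∈ reals /\ real_le real_zero s /\
    forall x y, x ∈ B -> y ∈ B -> real_le (ap d (pair x y)) s).
  apply definable_ext with (fun v => subset (v 0) X /\
    exists r, bound (v 0) r /\ forall s, bound (v 0) s -> real_le r s).
  - unfold bound, real_le, subset. dfn.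
  - intro v. generalize (v 0). intro B.
    assert (K : subset B X -> forall s, bound B s <->
      (s ∈ reals /\ real_le real_zero s /\
       forall x y, x ∈ B -> y ∈ B -> real_le (dist d x y) s)).
    { intros HB s. unfold bound.
      split; intros (H1 & H2 & H3); (split; [exact H1|]); (split; [exact H2|]);
        intros x y Hx Hy; specialize (H3 x y Hx Hy);
        rewrite (dist_ap X d x y Hd (HB x Hx) (HB y Hy)) in *; exact H3. }
    split; intros (HB & r & H1 & H2); (split; [exact HB|]); exists r; split.
    + now apply K.
    + intros s Hs. apply H2. now apply K.
    + apply K; [exact HB|exact H1].
    + intros s Hs. apply H2. apply K; [exact HB|exact Hs].
Qed.

Lemma FB_universe X : bornological_universe X (discrete_topology X) (FB X).
Proof.
  split.
  - unfold is_topology, discrete_topology. split; [now intro|]. rewrite !in_powerset.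
    split; [intros x H; now apply in_empty in H|]. split; [now intro|]. split.
    + intros S HS. apply in_powerset. intros x Hx. apply in_bigunion in Hx.
      destruct Hx as (y & Hy & Hx). apply HS, in_powerset in Hy. auto.
    + intros A B HA _. apply in_powerset in HA. apply in_powerset. intros x Hx.
      apply in_inter in Hx. apply HA. tauto.
  - split; [|split; [|split; [|split]]].
    + intros A HA. apply in_FB in HA. apply in_powerset. tauto.
    + apply mem_nonempty with empty. apply in_FB. split; [|apply finite_empty].
      intros x H. now apply in_empty in H.
    + intros A B HA HB. apply in_FB in HA. destruct HA as (HA & F). apply in_FB. split.
      * intros x Hx. auto.
      * now apply finite_subset with A.
    + intros A B HA HB. apply in_FB in HA, HB. apply in_FB. split.
      * intros x Hx. apply in_union in Hx. destruct Hx; [now apply HA|now apply HB].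
      * now apply finite_union.
    + intros x Hx. apply in_FB. split; [|apply finite_single].
      intros y Hy. apply in_single in Hy. now subst.
Qed.

(** The guard [ap h x ∈ omega] makes the statement meaningful for every finite set, inside the
    domain of [h] or not, as induction over all finite sets requires. *)
Lemma finite_bounded h A : finite A ->
  exists n : N, forall x, x ∈ A -> ap h x ∈ omega -> ap h x ∈ val n.
Proof.
  intro HA.
  assert (K : exists n, n ∈ omega /\ forall x, x ∈ A -> ap h x ∈ omega -> ap h x ∈ n).
  { revert A HA.
    refine (finite_ind
      (fun A => exists n, n ∈ omega /\ forall x, x ∈ A -> ap h x ∈ omega -> ap h x ∈ n) _ _ _).
    - dfn.
    - exists empty. split; [apply omega_0|]. intros x Hx. now apply in_empty in Hx.
    - intros A x _ (n & Hn & K). destruct (val_surj n Hn) as (n' & ->).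
      destruct (classic (ap h x ∈ omega)) as [Hx|Hx].
      + destruct (val_surj _ Hx) as (m & E). exists (val (plus n' (plus m one))).
        split; [apply val_omega|]. intros y Hy Ho.
        apply in_union in Hy. rewrite in_single in Hy. destruct Hy as [Hy| ->].
        * specialize (K y Hy Ho). destruct (val_surj _ Ho) as (k & Ek). rewrite Ek in *.
          apply mem_lt in K. apply mem_lt. eapply lt_le_trans; [exact K|]. now exists (plus m one).
        * rewrite E. apply mem_lt. exists n'. ring.
      + exists (val n'). split; [apply val_omega|]. intros y Hy Ho.
        apply in_union in Hy. rewrite in_single in Hy. destruct Hy as [Hy| ->]; auto.
        contradiction. }
  destruct K as (n & Hn & K). destruct (val_surj n Hn) as (n' & ->). eauto.
Qed.

(* The metric is [d(x, y) = h(x) + h(y) + 1] for [x <> y]: it is at least [1], and a set containing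
   a point [a] and of diameter at most [n] lies in the union of [{a}] and of the preimage of [n]. *)
Lemma Hu_metrizable_of_finite_to_one X h : maps h X omega ->
  (forall n, n ∈ omega -> finite (sep X (fun x => ap h x = n))) ->
  Hu_metrizable X (discrete_topology X) (FB X).
Proof.
  intros Hh Fh. split; [apply FB_universe|].
  set (R := fun p r => exists x y, p = pair x y /\
    ((x = y /\ r = nreal empty) \/ (x <> y /\ r = nreal (succ (padd (ap h x) (ap h y)))))).
  assert (DR : definable (fun v => R (v 0) (v 1))) by (unfold R; dfn).
  set (d := graph (prod X X) reals R).
  assert (W : forall x, x ∈ X -> exists a : N, ap h x = val a).
  { intros x Hx. apply val_surj. now apply (maps_ap_in h X omega). }
  assert (V : forall a b : N, succ (padd (val a) (val b)) = val (plus (plus a b) one)).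
  { intros a b. exact (val_succ (plus a b)). }
  assert (Hd : maps d (prod X X) reals).
  { apply graph_maps; [exact DR| |].
    - intros p Hp. apply in_prod in Hp. destruct Hp as (x & y & Hx & Hy & ->).
      destruct (W x Hx) as (a & Ea), (W y Hy) as (b & Eb).
      destruct (classic (x = y)) as [E|E].
      + exists (nreal (val zero)). split; [apply in_reals, nreal_is_real|].
        exists x, y. auto.
      + exists (nreal (val (plus (plus a b) one))). split; [apply in_reals, nreal_is_real|].
        exists x, y. split; [reflexivity|]. right. now rewrite Ea, Eb, V.
    - intros p r s _ _ _ (x & y & -> & H) (x' & y' & E & K). apply pair_inj in E.
      destruct E as (<- & <-). destruct H as [(E & ->)|(E & ->)], K as [(E' & ->)|(E' & ->)];
        first [contradiction | reflexivity]. }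
  assert (Dist : forall x y r, x ∈ X -> y ∈ X -> R (pair x y) r -> r ∈ reals -> dist d x y = r).
  { intros x y r Hx Hy H Hr. rewrite (dist_ap X) by assumption. symmetry.
    apply (maps_ap d (prod X X) reals _ _ Hd); [now apply in_prod_pair|].
    apply in_graph; [exact DR|]. rewrite in_prod_pair. auto. }
  assert (D0 : forall x, x ∈ X -> dist d x x = nreal (val zero)).
  { intros x Hx. apply Dist; auto; [exists x, x; auto|apply in_reals, nreal_is_real]. }
  assert (D1 : forall (x y : M) (a b : N), x ∈ X -> y ∈ X -> x <> y -> ap h x = val a -> ap h y = val b ->
    dist d x y = nreal (val (plus (plus a b) one))).
  { intros x y a b Hx Hy E Ea Eb. apply Dist; auto; [|apply in_reals, nreal_is_real].
    exists x, y. split; [reflexivity|]. right. now rewrite Ea, Eb, V. }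
  assert (Z : (real_zero : M) = nreal (val zero)) by (symmetry; exact nreal_zero).
  assert (Dv : forall x y, x ∈ X -> y ∈ X -> exists n : N, dist d x y = nreal (val n)).
  { intros x y Hx Hy. destruct (W x Hx) as (a & Ea), (W y Hy) as (b & Eb).
    destruct (classic (x = y)) as [<-|E].
    - exists zero. now apply D0.
    - exists (plus (plus a b) one). now apply D1. }
  assert (Hm : is_metric X d).
  { split; [exact Hd|]. rewrite Z. split; [|split; [|split]].
    - intros x y Hx Hy. destruct (W x Hx) as (a & Ea), (W y Hy) as (b & Eb).
      destruct (classic (x = y)) as [<-|E].
      + rewrite D0 by assumption. now intro.
      + rewrite (D1 x y a b) by assumption. apply nreal_le, le_zero.
    - intros x y Hx Hy. destruct (W x Hx) as (a & Ea), (W y Hy) as (b & Eb).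
      split; [|intros <-; auto]. intro K. apply NNPP. intro E.
      rewrite (D1 x y a b) in K by assumption. apply nreal_inj in K.
      now apply plus_one_nonzero in K.
    - intros x y Hx Hy. destruct (W x Hx) as (a & Ea), (W y Hy) as (b & Eb).
      destruct (classic (x = y)) as [<-|E]; [reflexivity|].
      rewrite (D1 x y a b), (D1 y x b a) by auto. do 2 f_equal. ring.
    - intros x y z Hx Hy Hz.
      destruct (W x Hx) as (a & Ea), (W y Hy) as (b & Eb), (W z Hz) as (c & Ec).
      destruct (classic (x = z)) as [<-|Exz].
      { destruct (Dv x y Hx Hy) as (m & Em), (Dv y x Hy Hx) as (n & En).
        rewrite D0, Em, En, nreal_add by assumption. apply nreal_le, le_zero. }
      rewrite (D1 x z a c) by assumption.
      destruct (classic (x = y)) as [<-|Exy].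
      { rewrite D0, (D1 x z a c), nreal_add by assumption. apply nreal_le. exists zero. ring. }
      rewrite (D1 x y a b) by assumption.
      destruct (classic (y = z)) as [<-|Eyz].
      { rewrite Ec in Eb. apply val_inj in Eb. subst c.
        rewrite D0, nreal_add by assumption. apply nreal_le. exists zero. ring. }
      rewrite (D1 y z b c), nreal_add by assumption. apply nreal_le.
      exists (plus (plus b b) one). ring. }
  exists d. split; [exact Hm|]. split.
  - symmetry. apply setof_eq. intro A. unfold discrete_topology. rewrite in_powerset.
    split; [|tauto]. intro HA. split; [exact HA|]. intros x Hx.
    (* Distinct points are at distance at least 1, so an open ball of radius 1 is a singleton and
       every subset is open. *)
    exists (nreal (val one)). split; [apply in_reals, nreal_is_real|]. rewrite Z. split.
    + split; [apply nreal_le; exists one; ring|]. intro E. apply nreal_inj in E.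
      apply (plus_one_nonzero (M := M) zero). rewrite <- E. ring.
    + intros y Hy. apply in_ball in Hy; auto. destruct Hy as (Hy & L & Ne).
      destruct (classic (x = y)) as [<-|E]; [exact Hx|]. destruct Ne.
      apply subset_antisym; [exact L|].
      destruct (W x) as (a & Ea), (W y Hy) as (b & Eb); auto.
      rewrite (D1 x y a b) by auto. apply nreal_le. exists (plus a b). ring.
  - symmetry. apply setof_eq. intro A. rewrite in_FB. split; intros (HA & K); (split; [exact HA|]).
    + destruct (finite_bounded h A K) as (n & Hn).
      assert (L : forall x, x ∈ A -> exists a : N, ap h x = val a /\ lt a n).
      { intros x Hx. destruct (W x (HA x Hx)) as (a & Ea). exists a. split; [exact Ea|].
        apply mem_lt. rewrite <- Ea. apply Hn; [exact Hx|]. rewrite Ea. apply val_omega. }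
      (* All values of [h] on [A] are strictly below [n], so [h x + h y + 1] stays below [2n]. *)
      apply (has_diam_bounded X d A (plus n n) Hm HA). intros x y Hx Hy.
      destruct (classic (x = y)) as [<-|E].
      * rewrite D0 by auto. apply nreal_le, le_zero.
      * destruct (L x Hx) as (a & Ea & (k & Ek)), (L y Hy) as (b & Eb & (l & El)).
        rewrite (D1 x y a b) by auto. apply nreal_le. exists (plus (plus k l) one).
        transitivity (plus (plus (plus a k) one) (plus (plus b l) one)); [|ring].
        now rewrite <- Ek, <- El.
    + destruct K as (r & (Hr & _ & Br) & _). apply in_reals, real_archimedean in Hr.
      destruct Hr as (n & Hr).
      destruct (classic (A = empty)) as [->|Ne]; [apply finite_empty|].
      apply nonempty in Ne. destruct Ne as (z & Hz).
      apply finite_subset with (union (sep X (fun x => ap h x ∈ val n)) (single z)).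
      * apply finite_add. apply finite_preimages; auto. apply val_omega.
      * intros x Hx. apply in_union. rewrite in_single.
        destruct (classic (x = z)) as [E|E]; [auto|]. left. apply in_sep; [dfn|].
        split; [auto|]. destruct (W x (HA x Hx)) as (a & Ea), (W z (HA z Hz)) as (b & Eb).
        assert (L : real_le (dist d x z) (nreal (val n))).
        { intros q Hq. apply Hr. now apply (Br x z). }
        rewrite (D1 x z a b) in L by auto. apply nreal_le in L. destruct L as (k & L).
        rewrite Ea. apply mem_lt. exists (plus b k). rewrite L. ring.
Qed.

Lemma finite_to_one_of_Hu_metrizable X tau : Hu_metrizable X tau (FB X) ->
  exists h, maps h X omega /\
    forall n, n ∈ omega -> finite (sep X (fun x => ap h x = n)).
Proof.
  intros (_ & d & Hm & _ & E).
  (* The empty space has no base point [z]; the empty function serves there. *)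
  destruct (classic (X = empty)) as [->|Ne].
  { exists empty. split.
    - split; [intros x Hx; now apply in_empty in Hx|]. intros x Hx. now apply in_empty in Hx.
    - intros n _. apply finite_subset with empty; [apply finite_empty|].
      intros x Hx. apply in_sep in Hx; [|dfn]. tauto. }
  apply nonempty in Ne. destruct Ne as (z & Hz).
  pose proof Hm as (Hd & _ & _ & Sym & Tri).
  set (P := fun x n => real_le (ap d (pair z x)) (nreal n)).
  assert (DP : definable (fun v => P (v 0) (v 1))) by (unfold P, real_le, subset; dfn).
  set (R := fun x n => P x n /\ forall m, m ∈ n -> ~ P x m).
  assert (DR : definable (fun v => R (v 0) (v 1))) by (unfold R; dfn).
  assert (Hh : maps (graph X omega R) X omega).
  { apply graph_maps; [exact DR| |].
    - intros x Hx. apply (omega_least (P x)); [dfn|].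
      destruct (real_archimedean (dist d z x)) as (n & Hn); [now apply (dist_real X)|].
      exists (val n). split; [apply val_omega|]. unfold P. now rewrite <- (dist_ap X).
    - intros x m n _ Hm' Hn (Pm & Lm) (Pn & Ln). now apply (least_unique (P x)). }
  exists (graph X omega R). split; [exact Hh|]. intros n Hn.
  set (F := sep X (fun x => ap (graph X omega R) x = n)).
  assert (HF : forall x, x ∈ F -> x ∈ X /\ real_le (dist d z x) (nreal n)).
  { intros x Hx. apply in_sep in Hx; [|dfn]. destruct Hx as (Hx & K). split; [exact Hx|].
    symmetry in K. apply (maps_ap _ _ _ _ _ Hh Hx) in K. apply in_graph in K; [|exact DR].
    destruct K as (_ & _ & K & _). unfold P in K. now rewrite (dist_ap X). }
  destruct (val_surj n Hn) as (k & ->).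
  (* The fibre is finite as soon as it is bounded, since the two bornologies coincide. Its points
     lie within [k] of [z], hence within [2k] of each other. *)
  apply (in_FB X F). rewrite E. apply in_metric_bornology; [exact Hm|].
  assert (FX : subset F X) by (intros x Hx; now apply HF).
  split; [exact FX|]. apply (has_diam_bounded X d F (plus k k) Hm FX).
  intros x y Hx Hy q Hq. rewrite <- nreal_add.
  destruct (HF x Hx) as (Xx & Lx), (HF y Hy) as (Xy & Ly).
  apply (Tri x z y Xx Hz Xy) in Hq. revert q Hq.
  apply real_add_mono; try apply nreal_is_real; try (now apply (dist_real X)).
  - rewrite Sym by assumption. exact Lx.
  - exact Ly.
Qed.

(* [s^2 + a] with [a <= s] determines [s], as it lies in the interval from [s^2] to [(s + 1)^2 - 1]. *)
Lemma code_inj (a b a' b' : N) :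
  plus (times (plus a b) (plus a b)) a = plus (times (plus a' b') (plus a' b')) a' ->
  a = a' /\ b = b'.
Proof.
  assert (K : forall a b a' b' : N, lt (plus a b) (plus a' b') ->
    plus (times (plus a b) (plus a b)) a <> plus (times (plus a' b') (plus a' b')) a').
  { clear. intros a b a' b' (k & E) H. rewrite E in H.
    (* With s = a + b and a' + b' = s + k + 1, this argument plus one is (s + k + 1)^2 + a' - (s^2 +
       a); the part a + 2b is 2s - a. Equal codes would make it zero. *)
    apply (plus_one_nonzero (plus (plus (plus a (plus b b))
      (plus (times (plus k k) (plus a b)) (plus (times k k) (plus k k)))) a')).
    symmetry. apply (plus_cancel _ _ (plus (times (plus a b) (plus a b)) a)).
    etransitivity; [apply (SRadd_0_l N_semiring)|]. etransitivity; [exact H|]. ring. }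
  intro H.
  assert (E : plus a b = plus a' b').
  { destruct (le_or_lt (plus a b) (plus a' b')) as [L|L].
    - destruct (le_eq_or_lt _ _ L) as [E|L']; [exact E|]. now apply K in H.
    - symmetry in H. now apply K in H. }
  rewrite E in H.
  assert (Ea : a = a').
  { apply (plus_cancel _ _ (times (plus a' b') (plus a' b'))).
    etransitivity; [apply (SRadd_comm N_semiring)|]. rewrite H. apply (SRadd_comm N_semiring). }
  split; [exact Ea|]. subst a'. apply (plus_cancel _ _ a).
  etransitivity; [apply (SRadd_comm N_semiring)|]. rewrite E. apply (SRadd_comm N_semiring).
Qed.

(** * Finite-to-one maps, countability and choice *)

Lemma countable_of_finite_to_one X h : CC_fin M -> maps h X omega ->
  (forall n, n ∈ omega -> finite (sep X (fun x => ap h x = n))) -> countable X.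
Proof.
  intros CC Hh Fh.
  (* CC(fin) speaks only of non-void collections, so the case without nonempty fibres is treated
     apart. *)
  destruct (classic (X = empty)) as [->|Ne].
  { apply countable_intro with (fun _ _ => False); [dfn|..]; intros a; intros;
      exfalso; now apply (in_empty a). }
  apply nonempty in Ne. destruct Ne as (x0 & Hx0).
  set (fib := fun n => sep X (fun x => ap h x = n)).
  assert (Dfib : defterm (fun v => fib (v 0))) by (unfold fib; dfn).
  assert (Hfib : forall n x, x ∈ fib n <-> x ∈ X /\ ap h x = n).
  { intros n x. unfold fib. rewrite in_sep by dfn. reflexivity. }
  (* Demanding the least possible [k] fixes the range of all enumerations of a fibre, so they lie in
     the powerset of one finite product; no uniqueness of finite cardinals has to be proved. *)
  set (enum := fun n => sep (powerset (prod (fib n) omega)) (fun f =>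
    exists k, k ∈ omega /\ bijection f (fib n) k /\ forall j, j ∈ k -> ~ equipollent (fib n) j)).
  assert (Denum : defterm (fun v => enum (v 0))) by (unfold enum; dfn).
  assert (Henum : forall n f, f ∈ enum n <-> exists k, k ∈ omega /\ bijection f (fib n) k /\
    forall j, j ∈ k -> ~ equipollent (fib n) j).
  { intros n f. unfold enum. rewrite in_sep by dfn. split; [tauto|].
    intro H. split; [|exact H]. destruct H as (k & Hk & ((S & _) & _) & _).
    apply in_powerset. intros p Hp. apply S, in_prod in Hp.
    destruct Hp as (a & b & Ha & Hb & ->). apply in_prod_pair. split; [exact Ha|].
    now apply (omega_trans k). }
  assert (Least : forall n, n ∈ omega -> exists k, k ∈ omega /\ equipollent (fib n) k /\
    forall j, j ∈ k -> ~ equipollent (fib n) j).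
  { intros n Hn. apply (omega_least (equipollent (fib n))); [dfn|]. exact (Fh n Hn). }
  set (C := sep (powerset (powerset (prod X omega)))
    (fun c => exists n, n ∈ omega /\ fib n <> empty /\ c = enum n)).
  assert (HC : forall c, c ∈ C <-> exists n, n ∈ omega /\ fib n <> empty /\ c = enum n).
  { intro c. unfold C. rewrite in_sep by dfn. split; [tauto|]. intro H. split; [|exact H].
    destruct H as (n & Hn & _ & ->). apply in_powerset. intros f Hf. apply in_powerset.
    intros p Hp. apply Henum in Hf. destruct Hf as (k & Hk & ((S & _) & _) & _).
    apply S, in_prod in Hp. destruct Hp as (a & b & Ha & Hb & ->). apply in_prod_pair.
    split; [now apply Hfib in Ha|now apply (omega_trans k)]. }
  destruct (CC C) as (c & Hc & Cc).
  - apply mem_nonempty with (enum (ap h x0)). apply HC. exists (ap h x0).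
    split; [now apply (maps_ap_in h X)|]. split; [|reflexivity].
    apply mem_nonempty with x0. now apply Hfib.
  - apply countable_intro with (fun c n => fib n <> empty /\ c = enum n); [dfn|..].
    + intros c Hc. now apply HC.
    + intros a b n _ _ _ (_ & ->) (_ & ->). reflexivity.
  - intros A HA. apply HC in HA. destruct HA as (n & Hn & Nn & ->).
    destruct (Least n Hn) as (k & Hk & (f & Hf) & Lk). split.
    + apply mem_nonempty with f. apply Henum. eauto.
    + apply finite_subset with (powerset (prod (fib n) k)).
      * apply finite_powerset, finite_prod; [now apply Fh|now apply finite_omega].
      * intros g Hg. apply Henum in Hg. destruct Hg as (l & Hl & Bg & Ll).
        replace k with l; [apply in_powerset; apply Bg|].
        apply (least_unique (equipollent (fib n))); auto; [now exists g|now exists f].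
  - intros A B HA HB NE. apply HC in HA, HB. destruct HA as (m & Hm & _ & ->).
    destruct HB as (n & Hn & _ & ->). apply NNPP. intro I. apply nonempty in I.
    destruct I as (f & Hf). apply in_inter in Hf. destruct Hf as (Fm & Fn).
    apply Henum in Fm, Fn. destruct Fm as (k & _ & Bm & _), Fn as (l & _ & Bn & _).
    (* A common element [f] has both fibres as its domain; the fibres are then equal, and so are
       their sets of enumerations. *)
    destruct NE. unfold enum. replace (fib n) with (fib m); [reflexivity|].
    apply zf_extensionality. intro x. split; intro Hx.
    + destruct (maps_unique f (fib m) k x) as (b & _ & K); [apply Bm|exact Hx|].
      apply (bijection_dom f (fib n) l x b); [exact Bn|now apply K].
    + destruct (maps_unique f (fib n) l x) as (b & _ & K); [apply Bn|exact Hx|].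
      apply (bijection_dom f (fib m) k x b); [exact Bm|now apply K].
  - assert (Hch : forall x, x ∈ X -> ap c (enum (ap h x)) ∈ enum (ap h x)).
    { intros x Hx. assert (K : enum (ap h x) ∈ C).
      { apply HC. exists (ap h x). split; [now apply (maps_ap_in h X)|].
        split; [|reflexivity]. apply mem_nonempty with x. now apply Hfib. }
      rewrite <- (app_ap c C (bigunion C)) by assumption. now apply Cc. }
    (* The code of [x] is that of the pair formed by its fibre index [h x] and its place [y] in the
       chosen enumeration, under the pairing of [code_inj]. *)
    apply countable_intro with (fun x m => exists y, y ∈ omega /\
      pair x y ∈ ap c (enum (ap h x)) /\
      m = padd (pmul (padd (ap h x) y) (padd (ap h x) y)) (ap h x)); [dfn|..].
    + intros x Hx. pose proof (Hch x Hx) as K. apply Henum in K.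
      destruct K as (k & Hk & (Bf & _) & _).
      destruct (maps_unique _ _ _ x Bf) as (y & Hy & K); [now apply Hfib|].
      pose proof (omega_trans k Hk y Hy) as Yo. pose proof (maps_ap_in h X omega x Hh Hx) as Ho.
      exists (padd (pmul (padd (ap h x) y) (padd (ap h x) y)) (ap h x)).
      split; [auto using padd_in, pmul_in|]. exists y. split; [exact Yo|]. split; [|reflexivity].
      now apply K.
    + intros x x' m Hx Hx' _ (y & Hy & P & ->) (y' & Hy' & P' & E).
      pose proof (maps_ap_in h X omega x Hh Hx) as Ho.
      pose proof (maps_ap_in h X omega x' Hh Hx') as Ho'.
      destruct (val_surj _ Ho) as (a & Ea), (val_surj _ Ho') as (a' & Ea').
      destruct (val_surj _ Hy) as (b & ->), (val_surj _ Hy') as (b' & ->).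
      rewrite Ea, Ea' in E. apply (val_inj (plus (times (plus a b) (plus a b)) a)
        (plus (times (plus a' b') (plus a' b')) a')) in E.
      apply code_inj in E. destruct E as (<- & <-).
      rewrite Ea' in P'. pose proof (Hch x Hx) as K. rewrite Ea in P, K. apply Henum in K.
      destruct K as (k & _ & K & _). now apply (bijection_inj _ _ _ x x' (val b) K).
Qed.

Lemma choice_of_countable_union C : countable (bigunion C) ->
  (forall A, A ∈ C -> A <> empty) -> exists f, choice_function f C.
Proof.
  intros H NE. apply countable_injection in H. destruct H as (e & He & Ie).
  set (R := fun A x => x ∈ A /\ forall y, y ∈ A -> ~ ap e y ∈ ap e x).
  assert (DR : definable (fun v => R (v 0) (v 1))) by (unfold R; dfn).
  assert (U : forall A x, A ∈ C -> x ∈ A -> x ∈ bigunion C).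
  { intros A x HA Hx. apply in_bigunion. eauto. }
  assert (Hf : maps (graph C (bigunion C) R) C (bigunion C)).
  { apply graph_maps; [exact DR| |].
    - intros A HA. destruct (nonempty A (NE A HA)) as (x & Hx).
      destruct (omega_least (fun n => exists x, x ∈ A /\ ap e x = n)) as (n & _ & (y & Hy & <-) & L).
      (* From here a point of [A] with least [e]-value is found; it is unique because [e] is
         injective on the union, so the relation [R] is a function. *)
      + dfn.
      + exists (ap e x). split; [|eauto]. apply (maps_ap_in e (bigunion C)); eauto.
      + exists y. split; [eauto|]. split; [exact Hy|]. intros z Hz K. apply (L _ K). eauto.
    - intros A x y HA _ _ (Hx & Lx) (Hy & Ly). apply Ie; eauto.
      destruct (omega_total (ap e x) (ap e y)) as [K|[K|K]];
        try (apply (maps_ap_in e (bigunion C)); eauto).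
      + now apply Ly in K.
      + exact K.
      + now apply Lx in K. }
  exists (graph C (bigunion C) R). split; [exact Hf|]. intros A HA.
  rewrite (app_ap _ _ _ _ Hf HA).
  assert (K : pair A (ap (graph C (bigunion C) R) A) ∈ graph C (bigunion C) R)
    by now apply (maps_ap _ _ _ _ _ Hf HA).
  apply in_graph in K; [|exact DR]. apply K.
Qed.

End Metrics.

Theorem theorem7p1 (M : ZF_model) :
  CC_fin M <->
  (forall X : M, Hu_metrizable X (discrete_topology X) (FB X) <-> countable X).
Proof.
  split.
  - intros CC X. split.
    + intro H. destruct (finite_to_one_of_Hu_metrizable _ _ H) as (h & Hh & Fh).
      now apply (countable_of_finite_to_one X h).
    + intro H. destruct (countable_injection X H) as (h & Hh & Ih).
      apply (Hu_metrizable_of_finite_to_one X h Hh). intros n Hn.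
      (* The fibres of an injection have at most one point. *)
      destruct (classic (sep X (fun x => ap h x = n) = empty)) as [->|Ne];
        [apply finite_empty|].
      apply nonempty in Ne. destruct Ne as (x & Hx).
      apply finite_subset with (single x); [apply finite_single|]. intros y Hy.
      apply in_sep in Hx; [|dfn]. apply in_sep in Hy; [|dfn]. apply in_single.
      apply Ih; try tauto. destruct Hx as (_ & ->), Hy as (_ & ->). reflexivity.
  - intros H C _ HC FC DC. apply choice_of_countable_union; [|intros A HA; now apply FC].
    apply H. destruct (countable_injection C HC) as (g & Hg & Ig).
    (* Each point is sent to the index of the member of [C] containing it, a single value because
       the members are disjoint. *)
    set (R := fun x n => exists A, A ∈ C /\ x ∈ A /\ n = ap g A).
    assert (DR : definable (fun v => R (v 0) (v 1))) by (unfold R; dfn).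
    assert (U : forall A B x, A ∈ C -> B ∈ C -> x ∈ A -> x ∈ B -> A = B).
    { intros A B x HA HB Ha Hb. apply NNPP. intro NE.
      apply (in_empty x). rewrite <- (DC A B HA HB NE). apply in_inter. auto. }
    assert (Hh : maps (graph (bigunion C) omega R) (bigunion C) omega).
    { apply graph_maps; [exact DR| |].
      - intros x Hx. apply in_bigunion in Hx. destruct Hx as (A & HA & Hx).
        exists (ap g A). split; [now apply (maps_ap_in g C)|]. exists A. auto.
      - intros x m n _ _ _ (A & HA & Ha & ->) (B & HB & Hb & ->).
        now rewrite (U A B x HA HB Ha Hb). }
    apply (Hu_metrizable_of_finite_to_one _ _ Hh). intros n Hn.
    set (F := sep (bigunion C) (fun x => ap (graph (bigunion C) omega R) x = n)).
    assert (HF : forall x, x ∈ F -> R x n).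
    { intros x Hx. apply in_sep in Hx; [|dfn]. destruct Hx as (Hx & K). symmetry in K.
      apply (maps_ap _ _ _ _ _ Hh Hx) in K. apply in_graph in K; [|exact DR]. tauto. }
    destruct (classic (F = empty)) as [->|Ne]; [apply finite_empty|].
    apply nonempty in Ne. destruct Ne as (x & Hx).
    (* The indexing [g] is injective, so a nonempty fibre is contained in one member of [C], which
       is finite. *)
    destruct (HF x Hx) as (A & HA & _ & EA). apply finite_subset with A; [now apply FC|].
    intros y Hy. destruct (HF y Hy) as (B & HB & Yb & EB).
    rewrite (Ig A B HA HB); [exact Yb|congruence].
Qed.
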